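(* Let $d\ge 1$, $n\ge 2$, $\Sigma,\Sigma_1,\dots,\Sigma_n\in\mathcal{S}_+(d)$ and $(p_1,\dots,p_n)\in(0,1)^n$ with $\sum_{i=1}^n p_i=1$. Consider the following four conditions. (A) There exists $(M,C)\in\mathcal{I}(d)\times\mathcal{C}(d)$ such that $C$ is a correlation matrix associated with $M\Sigma_iM^*$ for every $i\in\{1,\dots,n\}$ and $$M\Sigma M^*\le DCD,\quad\text{where } D=\mathrm{diag}\Big(\sum_{i=1}^np_i\sqrt{(M\Sigma_iM^* )_{11}},\dots,\sum_{i=1}^np_i\sqrt{(M\Sigma_iM^* )_{dd}}\Big).$$ (B) There exists $\Gamma\in\mathcal{S}_+(nd)$ such that $\Sigma\le(p_1I_d,\dots,p_nI_d)\,\Gamma\,(p_1I_d,\dots,p_nI_d)^*$ and, for all $i\in\{1,\dots,n\}$, $\Gamma_{(i-1)d+1:id,(i-1)d+1:id}=\Sigma_i$. (C) For all $x_1,\dots,x_n\in\mathbb{R}^d$ such that $\sum_{i=1}^np_ix_i=0$, $\ \mathcal{N}_d(0,\Sigma)\le_{cx}\sum_{i=1}^np_i\,\mathcal{N}_d(x_i,\Sigma_i)$. (D) For all $\xi\in\mathbb{R}^d$, $\ \sqrt{\xi^*\Sigma\xi}\le\sum_{i=1}^np_i\sqrt{\xi^*\Sigma_i\xi}$. Then (A) implies (B), (B) implies (C), and (C) implies (D). Moreover, the four conditions (A), (B), (C), (D) are equivalent in each of the following cases: 1. the matrices $\Sigma_1,\dots,\Sigma_n$ are all colinear (i.e. there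 exist $\Theta\in\mathcal{S}_+(d)$ and $\sigma_1,\dots,\sigma_n\in[0,+\infty)$ with $\Sigma_i=\sigma_i\Theta$ for all $i$), and in particular when $d=1$; 2. there exists $N\in\mathcal{I}(d)$ such that $N\Sigma_iN^*N\Sigma_jN^*=0$ (equivalently $\Sigma_iN^*N\Sigma_j=0$) for all $i,j\in\{1,\dots,n\}$ with $i\ne j$, and in particular when $\Sigma_i\Sigma_j=0$ for all $i\neq j$; 3. there exists $N\in\mathcal{I}(d)$ such that the matrices $N\Sigma N^*,N\Sigma_1N^*,\dots,N\Sigma_nN^*$ commute (pairwise), and in particular when $\Sigma,\Sigma_1,\dots,\Sigma_n$ commute or when there exists $M\in\mathcal{I}(d)$ such that $M\Sigma M^*,M\Sigma_1M^*,\dots,M\Sigma_nM^*$ are all diagonal; 4. there exists $(M,C)\in\mathcal{I}(d)\times\mathcal{C}(d)$ such that $C$ is associated with all the matrices $M\Sigma_1M^*,\dots,M\Sigma_nM^*$ and with the matrix $\widehat\Sigma\in\mathbb{R}^{d\times d}$ whose diagonal entries are $\widehat\Sigma_{kk}=\big(\sum_{i=1}^np_i\sqrt{(M\Sigma_iM^* )_{kk}}\big)^2$, $k\in\{1,\dots,d\}$, and whose other entries are equal to those of $M\Sigma M^*$.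
   Context: $A^*$ denotes the transpose of a real matrix $A$. $\mathcal{S}_+(d)$ is the set of symmetric positive semi-definite matrices in $\mathbb{R}^{d\times d}$; $\mathcal{I}(d)$ is the set of non-singular matrices in $\mathbb{R}^{d\times d}$; $\mathcal{C}(d)=\{C\in\mathcal{S}_+(d): C_{ii}=1 \text{ for } i\in\{1,\dots,d\}\}$ is the set of correlation matrices; $I_d$ is the identity matrix. For symmetric $S,T\in\mathbb{R}^{d\times d}$, $S\le T$ means $T-S\in\mathcal{S}_+(d)$. For a matrix $A$, $A_{r_1:r_2,c_1:c_2}$ denotes the submatrix with rows $r_1,\dots,r_2$ and columns $c_1,\dots,c_2$. $(p_1I_d,\dots,p_nI_d)\in\mathbb{R}^{d\times nd}$ is the block row matrix. A matrix $C\in\mathcal{C}(d)$ is a correlation matrix associated with $\Theta\in\mathbb{R}^{d\times d}$ (with nonnegative diagonal entries) if $\Theta=\mathrm{diag}(\sqrt{\Theta_{11}},\dots,\sqrt{\Theta_{dd}})\,C\,\mathrm{diag}(\sqrt{\Theta_{11}},\dots,\sqrt{\Theta_{dd}})$ (this forces $\Theta\in\mathcal{S}_+(d)$; $C$ need not be unique when $\Theta$ is singular). $\mathcal{N}_d(\xi,\Sigma)$ is the (possibly degenerate) $d$-dimensional Gaussian law with expectation $\xi\in\mathbb{R}^d$ and covariance matrix $\Sigma\in\mathcal{S}_+(d)$. For probability measures $\mu,\nu$ on $\mathbb{R}^d$ with finite first-order moment, $\mu\le_{cx}\nu$ (convex order) means $\int\varphi\,d\mu\le\int\varphi\,d\nu$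 for every convex function $\varphi:\mathbb{R}^d\to\mathbb{R}$ (the integrals being well defined in $(-\infty,+\infty]$). $\sum_ip_i\mu_i$ denotes the mixture of the probability measures $\mu_i$ with weights $p_i$. *)

(* Defs.v *)
From HB Require Import structures.
From mathcomp Require Import all_boot all_order all_algebra.
From mathcomp Require Import all_classical all_reals all_analysis measurable_realfun.

Set Implicit Arguments.
Unset Strict Implicit.
Unset Printing Implicit Defensive.

Import Order.TTheory GRing.Theory Num.Theory.
Import numFieldNormedType.Exports.

Local Open Scope classical_set_scope.
Local Open Scope ring_scope.

Section matrices.
Context {R : realType}.

Definition qform d (A : 'M[R]_d) (x : 'cV[R]_d) : R :=
  (x^T *m A *m x) ord0 ord0.

Definition psdmx d (A : 'M[R]_d) : Prop :=
  A^T = A /\ forall x : 'cV[R]_d, 0 <= qform A x.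

Definition loewner_le d (S T : 'M[R]_d) : Prop := psdmx (T - S).

Definition corrmx d (C : 'M[R]_d) : Prop :=
  psdmx C /\ forall i, C i i = 1.

Definition diag_sqrt d (Theta : 'M[R]_d) : 'M[R]_d :=
  diag_mx (\row_k Num.sqrt (Theta k k)).

Definition is_corr_of d (C Theta : 'M[R]_d) : Prop :=
  [/\ corrmx C, forall k, 0 <= Theta k k &
      Theta = diag_sqrt Theta *m C *m diag_sqrt Theta].

End matrices.

Definition borelRd (R : realType) (d : nat) :=
  g_sigma_algebraType (@open 'cV[R]_d).

Section borelRd.
Context {R : realType}.

Lemma measurable_borelRdP dT (T : measurableType dT) d (f : T -> borelRd R d) :
  (forall i, measurable_fun setT (fun t => (f t : 'cV[R]_d) i ord0)) ->
  measurable_fun setT f.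
Proof.
move=> mf.
apply: (@measurability _ _ _ _ setT f (@open 'cV[R]_d)) => //.
move=> _ [U oU <-]; rewrite setTI.
pose box (c : 'cV[rat]_d * nat) : set 'cV[R]_d :=
  [set y | forall i, ball (ratr (c.1 i ord0) : R) (c.2.+1%:R^-1) (y i ord0)].
have -> : f @^-1` U =
    \bigcup_(c : 'cV[rat]_d * nat)
      (if `[< box c `<=` U >] then f @^-1` box c else set0).
  apply/seteqP; split=> [t /= Uft|t [c _]]; last first.
    by case: asboolP => // bU /bU.
  have /nbhs_ballP[e /= e0 eU] : nbhs (f t : 'cV[R]_d) U.
    exact: open_nbhs_nbhs.
  pose k := Num.truncn (2 / e).
  have ke : k.+1%:R^-1 + k.+1%:R^-1 < e.
    have -> : k.+1%:R^-1 + k.+1%:R^-1 = 2 / k.+1%:R :> R.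
      by rewrite mulrDl !mul1r.
    by rewrite (@ltr_pdivrMr R)// mulrC -(@ltr_pdivrMr R)// truncnS_gt.
  have /choice[c hc] : forall i : 'I_d, exists q : rat,
      ball (ratr q : R) k.+1%:R^-1 ((f t : 'cV[R]_d) i ord0).
    move=> i; set y := (f t : 'cV[R]_d) i ord0.
    have /rat_in_itvoo[q] : y < y + k.+1%:R^-1 by rewrite ltrDl.
    rewrite in_itv/= => /andP[yq qy]; exists q.
    by rewrite /ball/= ger0_norm ?subr_ge0 ?ltW// ltrBlDl.
  have bU : box (\col_i c i, k) `<=` U.
    move=> y yb; apply: eU; split=> // i j.
    rewrite (ord1 j); apply: le_ball (ltW ke) _ _.
    by apply: ball_triangle (yb i) => /=; rewrite mxE; exact/ball_sym.
  exists (\col_i c i, k) => //; rewrite asboolT//.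
  by move=> i /=; rewrite mxE.
apply: countable_bigcupT_measurable => [|c]; first exact: countableP.
case: ifP => // _.
have -> : f @^-1` box c = \bigcap_(i : 'I_d)
    ((fun t => (f t : 'cV[R]_d) i ord0) @^-1`
       ball (ratr (c.1 i ord0) : R) c.2.+1%:R^-1).
  by apply/seteqP; split=> t /= h i; [move=> _; exact: h|exact: h].
apply: fin_bigcap_measurable => // i _; rewrite -[X in measurable X]setTI.
by apply: mf => //; apply: open_measurable; exact: ball_open.
Qed.

Lemma measurable_coordRd d (i : 'I_d) :
  measurable_fun setT (fun x : borelRd R d => (x : 'cV[R]_d) i ord0).
Proof.
apply: (measurability _ (RGenOpens.measurableE R)) => //.
move=> _ [_ [a [b ->] <-]]; rewrite setTI; apply: sub_sigma_algebra.
move/continuousP : (@coord_continuous R d 1 i ord0); apply.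
exact: interval_open.
Qed.

Definition consRd d (xz : measurableTypeR R * borelRd R d) : borelRd R d.+1 :=
  (col_mx (xz.1%:M : 'cV[R]_1) (xz.2 : 'cV[R]_d) : 'cV[R]_(1 + d)).

Lemma measurable_consRd d : measurable_fun setT (@consRd d).
Proof.
apply: measurable_borelRdP => i; case: (@split_ordP 1 d i) => j ->.
  rewrite (_ : (fun _ => _) = fst)//; apply/funext => xz.
  apply: (etrans (col_mxEu _ _ _ _)).
  by rewrite mxE (ord1 j) mulr1n.
rewrite (_ : (fun _ => _) =
    (fun z : borelRd R d => (z : 'cV[R]_d) j ord0) \o snd); last first.
  by apply/funext => xz; exact: col_mxEd.
by apply: measurableT_comp => //; exact: measurable_coordRd.
Qed.

HB.instance Definition _ d :=
  isMeasurableFun.Build _ _ _ _ (@consRd d) (@measurable_consRd d).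

Definition affineRd d (a : 'cV[R]_d) (A : 'M[R]_d) (z : borelRd R d) :
  borelRd R d := a + A *m (z : 'cV[R]_d).

Lemma measurable_affineRd d a A : measurable_fun setT (@affineRd d a A).
Proof.
apply: measurable_borelRdP => i; rewrite /affineRd.
under eq_fun do rewrite !mxE.
apply: measurable_funD => //; apply: measurable_sum => j.
by apply: measurable_funM => //; exact: measurable_coordRd.
Qed.

HB.instance Definition _ d a A :=
  isMeasurableFun.Build _ _ _ _ (@affineRd d a A) (@measurable_affineRd d a A).

(* product of d copies of N(0, 1) *)
Fixpoint std_gaussian d : probability (borelRd R d) R :=
  if d is d'.+1 then
    distribution (normal_prob 0 1 \x std_gaussian d')%E
      (@consRd d' : {mfun (measurableTypeR R * borelRd R d')%type >-> borelRd R d'.+1})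
  else \d_((0 : 'cV[R]_0) : borelRd R 0).

(* N_d(xi, Sigma) is the law of xi + A Z with Z standard Gaussian and
   A A^T = Sigma.  Such an A exists whenever Sigma is psd (e.g. its psd square
   root), and the law does not depend on which one is picked; Sigma may be
   singular. The value is meaningless when Sigma is not psd. *)
Definition gaussian d (xi : 'cV[R]_d) (Sigma : 'M[R]_d) :
    probability (borelRd R d) R :=
  distribution (std_gaussian d)
    (affineRd xi (xget 0 [set A : 'M[R]_d | A *m A^T = Sigma])).

(* A plain set function; it is a probability measure when p is a probability
   vector. *)
Definition mixture n (p : 'I_n -> R) dT (T : measurableType dT)
    (mu : 'I_n -> probability T R) (A : set T) : \bar R :=
  (\sum_(i < n) (p i)%:E * mu i A)%E.

(* Meant for laws with finite first moment: a convex phi is bounded below by an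
   affine function, so its negative part is then integrable and neither
   integral is of the form oo - oo. *)
Definition convex_le d (mu nu : set (borelRd R d) -> \bar R) : Prop :=
  forall phi : 'cV[R]_d -> R,
    convex_function [set: convex_lmodType 'cV[R]_d] phi ->
    (\int[mu]_x (phi x)%:E <= \int[nu]_x (phi x)%:E)%E.

End borelRd.

Section conditions.
Context {R : realType} (d n : nat) (p : 'I_n -> R).
Context (Sigma : 'M[R]_d) (Sig : 'I_n -> 'M[R]_d).

Definition mean_std (M : 'M[R]_d) (k : 'I_d) : R :=
  \sum_(i < n) p i * Num.sqrt ((M *m Sig i *m M^T) k k).

Definition condA : Prop :=
  exists M C : 'M[R]_d,
    [/\ M \in unitmx, corrmx C,
        forall i, is_corr_of C (M *m Sig i *m M^T) &
        let D := diag_mx (\row_k mean_std M k) in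
        loewner_le (M *m Sigma *m M^T) (D *m C *m D)].

(* block matrices of size nd are indexed by \sum_(i < n) d *)
Definition condB : Prop :=
  exists Gamma : 'M[R]_(\sum_(i < n) d),
    let P : 'M[R]_(d, \sum_(i < n) d) := \mxrow_(i < n) (p i)%:M in
    [/\ psdmx Gamma, loewner_le Sigma (P *m Gamma *m P^T) &
        forall i, submxblock Gamma i i = Sig i].

Definition condC : Prop :=
  forall x : 'I_n -> 'cV[R]_d, \sum_(i < n) p i *: x i = 0 ->
    convex_le (gaussian 0 Sigma)
              (mixture p (fun i => gaussian (x i) (Sig i))).

Definition condD : Prop :=
  forall xi : 'cV[R]_d,
    Num.sqrt (qform Sigma xi) <=
    \sum_(i < n) p i * Num.sqrt (qform (Sig i) xi).

Definition colinear_family : Prop :=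
  exists (Theta : 'M[R]_d) (sigma : 'I_n -> R),
    [/\ psdmx Theta, forall i, 0 <= sigma i &
        forall i, Sig i = sigma i *: Theta].

Definition orthogonal_family : Prop :=
  exists2 N : 'M[R]_d, N \in unitmx &
    forall i j, i != j ->
      N *m Sig i *m N^T *m (N *m Sig j *m N^T) = 0.

Definition commuting_family : Prop :=
  exists N : 'M[R]_d,
    [/\ N \in unitmx,
        forall i, comm_mx (N *m Sigma *m N^T) (N *m Sig i *m N^T) &
        forall i j, comm_mx (N *m Sig i *m N^T) (N *m Sig j *m N^T)].

Definition Sigma_hat (M : 'M[R]_d) : 'M[R]_d :=
  \matrix_(k, l)
    if k == l then mean_std M k ^+ 2 else (M *m Sigma *m M^T) k l.

Definition common_corr : Prop :=
  exists M C : 'M[R]_d,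
    [/\ M \in unitmx, corrmx C,
        forall i, is_corr_of C (M *m Sig i *m M^T) &
        is_corr_of C (Sigma_hat M)].

End conditions.

(* Main.v *)
Require Import Defs.
From HB Require Import structures.
From mathcomp Require Import all_boot all_order all_algebra.
From mathcomp Require Import all_classical all_reals all_analysis.
From mathcomp Require Import measurable_realfun.
From mathcomp Require Import ring lra.
From mathcomp Require Import complex.

(** (A) implies (B) because the covariance matrices that share a correlation
matrix [C] after the change of variables [M] can be coupled by a single noise of
covariance [C], scaled differently in each component ([condA_condB]).

(B) implies (C) by Jensen's inequality. A factorisation [Gamma = G G^*] realises
the [n] Gaussian laws of covariances [Sig_i] on one standard Gaussian vector [Z],
as the laws of [x_i + G_i Z]. As [sum_i p_i x_i = 0], the barycentre
[sum_i p_i (x_i + G_i Z)] is centred with covariance [P Gamma P^*], where [P] is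
the row of blocks [p_i I]; Jensen's inequality compares it with the mixture
([convex_jensen_integral]). The law of covariance [Sigma] is smaller still, since
enlarging a covariance means adding a symmetric noise
([gaussian_loewner_convex]).

(C) implies (D) by testing on [x |-> |xi^* x|] ([condC_condD]).

All this rests on one fact about Gaussian laws: the law of [K Z] depends only on
[K K^*] ([gaussian_law_gram]). If [K K^* = L L^*], then, up to padding with null
columns, [L = K Q] with [Q] a product of reflections ([gram_eq_rotation]), and a
reflection is conjugate by plane rotations to a sign change. The invariance under plane rotations
([normal2_rotation]) follows from that of the Lebesgue measure, a rotation being
a product of three shears. Convex functions are handled through a lower bound
[phi (a + u) >= phi a - C |u|_1] ([convex_lower_bound]), which gives their
measurability and the integrability of their negative part.

In the four cases it remains to deduce (A) from (D). In the colinear case (D) is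
itself a Loewner inequality. In the orthogonal and commuting cases, the matrices
are first diagonalized simultaneously by a congruence
([orthogonal_codiagonalization]). In the commuting case, (D) at the basis vectors
is then the required inequality, with [C] the identity. In the orthogonal case
the diagonal forms have disjoint supports, which leaves the entries of [C]
between the supports free; they are chosen so that [DCD] agrees with
[M Sigma M^*] there ([disjoint_diag_condA]). In the last case [DCD] and
[M Sigma M^*] differ only on the diagonal, where (D) compares them. *)

Set Implicit Arguments.
Unset Strict Implicit.
Unset Printing Implicit Defensive.

Import Order.TTheory GRing.Theory Num.Theory.
Import numFieldNormedType.Exports.

Local Open Scope ring_scope.

(** * Positive semi-definite matrices *)

Section quadratic_forms.
Context {R : realType}.

Lemma qformD d (A B : 'M[R]_d) x : qform (A + B) x = qform A x + qform B x.
Proof. by rewrite /qform mulmxDr mulmxDl mxE. Qed.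

Lemma qformN d (A : 'M[R]_d) x : qform (- A) x = - qform A x.
Proof. by rewrite /qform mulmxN mulNmx mxE. Qed.

Lemma qformB d (A B : 'M[R]_d) x : qform (A - B) x = qform A x - qform B x.
Proof. by rewrite qformD qformN. Qed.

Lemma qformZ d a (A : 'M[R]_d) x : qform (a *: A) x = a * qform A x.
Proof. by rewrite /qform -scalemxAr -scalemxAl mxE. Qed.

Lemma qform_sum d I (r : seq I) (A : I -> 'M[R]_d) x :
  qform (\sum_(i <- r) A i) x = \sum_(i <- r) qform (A i) x.
Proof. by rewrite /qform mulmx_sumr mulmx_suml summxE. Qed.

Lemma qform_congr m d (M : 'M[R]_(m, d)) (A : 'M[R]_d) x :
  qform (M *m A *m M^T) x = qform A (M^T *m x).
Proof. by rewrite /qform trmx_mul trmxK !mulmxA. Qed.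

Lemma qform_gram m d (K : 'M[R]_(d, m)) x :
  qform (K *m K^T) x = \sum_i ((K^T *m x) i ord0) ^+ 2.
Proof.
rewrite -{1}[K]mulmx1 qform_congr /qform mulmx1 mxE.
by apply: eq_bigr => i _; rewrite mxE expr2.
Qed.

Lemma qform_diag d (v : 'rV[R]_d) x :
  qform (diag_mx v) x = \sum_i v ord0 i * (x i ord0) ^+ 2.
Proof.
rewrite /qform mul_mx_diag mxE; apply: eq_bigr => i _.
by rewrite !mxE expr2; ring.
Qed.

Lemma qform_delta d (A : 'M[R]_d) k : qform A (delta_mx k ord0) = A k k.
Proof. by rewrite /qform trmx_delta -rowE -colE !mxE. Qed.

Lemma psdmx_congr m d (M : 'M[R]_(m, d)) A : psdmx A -> psdmx (M *m A *m M^T).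
Proof.
move=> [sA pA]; split=> [|x]; first by rewrite !trmx_mul trmxK sA mulmxA.
by rewrite qform_congr.
Qed.

Lemma psdmx_gram m d (K : 'M[R]_(d, m)) : psdmx (K *m K^T).
Proof.
split=> [|x]; first by rewrite trmx_mul trmxK.
by rewrite qform_gram sumr_ge0 // => i _; rewrite sqr_ge0.
Qed.

Lemma psdmxD d (A B : 'M[R]_d) : psdmx A -> psdmx B -> psdmx (A + B).
Proof.
move=> [sA pA] [sB pB]; split=> [|x]; first by rewrite linearD /= sA sB.
by rewrite qformD addr_ge0.
Qed.

Lemma psdmx_diag d (v : 'rV[R]_d) : (forall i, 0 <= v ord0 i) -> psdmx (diag_mx v).
Proof.
move=> v0; split=> [|x]; first exact: tr_diag_mx.
by rewrite qform_diag sumr_ge0 // => i _; rewrite mulr_ge0 // sqr_ge0.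
Qed.

Lemma psdmx1 d : psdmx (1%:M : 'M[R]_d).
Proof. by rewrite -diag_const_mx; apply: psdmx_diag => i; rewrite mxE. Qed.

Lemma psdmx_sum d I (r : seq I) (A : I -> 'M[R]_d) :
  (forall i, psdmx (A i)) -> psdmx (\sum_(i <- r) A i).
Proof.
move=> pA; split=> [|x].
  by rewrite raddf_sum; apply: eq_bigr => i _; have [] := pA i.
by rewrite qform_sum sumr_ge0 // => i _; have [_] := pA i.
Qed.

Lemma loewner_diag d (v : 'rV[R]_d) A :
  is_diag_mx A -> (forall k, A k k <= v ord0 k) -> loewner_le A (diag_mx v).
Proof.
move=> /diag_mxP[w ->] wv; rewrite /loewner_le -raddfB; apply: psdmx_diag => k.
by have := wv k; rewrite !mxE eqxx mulr1n subr_ge0.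
Qed.

Lemma psdmx_diag_ge0 d (A : 'M[R]_d) k : psdmx A -> 0 <= A k k.
Proof. by move=> [_ pA]; rewrite -qform_delta. Qed.

Lemma diag_entry d (A : 'M[R]_d) k l : is_diag_mx A -> k != l -> A k l = 0.
Proof. by move=> /is_diag_mxP dA kl; apply: dA. Qed.

Lemma symmx_entry d (A : 'M[R]_d) k l : A^T = A -> A k l = A l k.
Proof. by move=> sA; rewrite -[in LHS]sA mxE. Qed.

(** Otherwise [x |-> qform A x] would be affine and non-constant along the line
[t e_k + e_l], hence negative somewhere. *)
Lemma psdmx_diag_eq0 d (A : 'M[R]_d) k l : psdmx A -> A k k = 0 -> A k l = 0.
Proof.
move=> [sA pA] Akk; have [//|Akl] := eqVneq (A k l) 0.
(* the value of t at which the form equals -1 *)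
pose t := - (A l l + 1) / (2 * A k l).
have := pA (t *: delta_mx k ord0 + delta_mx l ord0).
rewrite /qform [X in X *m A]raddfD /= [X in (X + _) *m A]linearZ /= !trmx_delta.
rewrite !(mulmxDl, mulmxDr) -!scalemxAl -!scalemxAr -!rowE -!colE !mxE Akk.
rewrite (symmx_entry l k sA) !mulr0 add0r.
suff -> : t * A k l + (t * A k l + A l l) = -1 by rewrite oppr_ge0 ler10.
rewrite /t; field; exact: Akl.
Qed.

(** Cholesky factorisation, by induction on the Schur complement of the first
diagonal entry. A zero pivot is harmless: its whole column vanishes by
[psdmx_diag_eq0]. The factor [G] turns a covariance matrix into a linear map to
apply to a standard Gaussian vector. *)
Lemma psdmx_factor d (A : 'M[R]_d) : psdmx A -> exists G : 'M[R]_d, A = G *m G^T.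
Proof.
elim: d A => [|d IH] A pA; first by exists 0; apply/matrixP => -[].
move: A pA; rewrite -[d.+1]/(1 + d)%N => A pA.
have [sA _] := pA.
set a := A ord0 ord0; set v := dlsubmx A; set H := drsubmx A.
have defA : A = block_mx a%:M v^T v H.
  rewrite -[LHS]submxK; congr block_mx.
    by rewrite [LHS]mx11_scalar; congr (_%:M); rewrite !mxE; congr (A _ _);
      apply: val_inj.
  by rewrite /v trmx_dlsub sA.
have a0 : 0 <= a := psdmx_diag_ge0 ord0 pA.
have [az|anz] := eqVneq a 0.
  have v0 : v = 0.
    apply/matrixP => i j; rewrite !mxE (ord1 j) (symmx_entry _ _ sA).
    have -> : lshift d ord0 = ord0 :> 'I_(1 + d) by apply: val_inj.
    exact: psdmx_diag_eq0 pA az.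
  have /IH[G HG] : psdmx H.
    have := psdmx_congr (row_mx 0 1%:M : 'M[R]_(d, 1 + d)) pA.
    rewrite defA tr_row_mx mul_row_block !mul0mx !mul1mx !add0r mul_row_col.
    by rewrite trmx1 trmx0 mulmx0 mulmx1 add0r.
  exists (block_mx 0 0 0 G); rewrite defA az v0 HG.
  rewrite tr_block_mx mulmx_block !trmx0 !mulmx0 !mul0mx !addr0 !add0r.
  by rewrite raddf0.
have agt0 : 0 < a by rewrite lt_def anz.
(* congruence by the row block (w, 1) produces the Schur complement *)
pose w := - a^-1 *: v.
have /IH[G HG] : psdmx (H - a^-1 *: (v *m v^T)).
  have := psdmx_congr (row_mx w 1%:M : 'M[R]_(d, 1 + d)) pA.
  rewrite defA tr_row_mx mul_row_block !mul1mx mul_row_col.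
  rewrite trmx1 mulmx1 mul_mx_scalar /w scalerA mulrN divff // scaleN1r addNr.
  by rewrite mul0mx add0r -scalemxAl scaleNr addrC.
exists (block_mx (Num.sqrt a)%:M 0 ((Num.sqrt a)^-1 *: v) G); rewrite defA.
have sa : Num.sqrt a != 0 by rewrite sqrtr_eq0 -ltNge.
rewrite tr_block_mx mulmx_block !trmx0 !mulmx0 !mul0mx !addr0 -HG.
rewrite linearZ /= tr_scalar_mx -scalar_mxM -expr2 sqr_sqrtr //.
rewrite mul_scalar_mx mul_mx_scalar !scalerA divff // !scale1r.
by rewrite -scalemxAl -scalemxAr scalerA -expr2 exprVn sqr_sqrtr // addrC subrK.
Qed.

End quadratic_forms.

(** * Correlation matrices *)

Section correlation.
Context {R : realType}.

(** When a diagonal entry of [Theta] vanishes, the convention [x / 0 = 0] makes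
the corresponding component uncorrelated with the others. *)
Definition corr_of d (Theta : 'M[R]_d) : 'M[R]_d :=
  \matrix_(k, l) if k == l then 1
    else Theta k l / (Num.sqrt (Theta k k) * Num.sqrt (Theta l l)).

Lemma diag_sqrt_congrE d (Theta C : 'M[R]_d) k l :
  (diag_sqrt Theta *m C *m diag_sqrt Theta) k l =
  Num.sqrt (Theta k k) * C k l * Num.sqrt (Theta l l).
Proof. by rewrite /diag_sqrt mul_mx_diag mul_diag_mx !mxE. Qed.

Lemma corr_ofP d (Theta : 'M[R]_d) :
  psdmx Theta -> is_corr_of (corr_of Theta) Theta.
Proof.
move=> pT; have T0 k := psdmx_diag_ge0 k pT; have [sT _] := pT.
split=> //; last first.
  apply/matrixP => k l; rewrite diag_sqrt_congrE mxE.
  have [<-|kl] := eqVneq k l; first by rewrite mulr1 -expr2 sqr_sqrtr.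
  have [Tk|Tk] := eqVneq (Num.sqrt (Theta k k)) 0.
    rewrite Tk !mul0r; apply: psdmx_diag_eq0 => //.
    by apply/eqP; rewrite eq_le T0 -sqrtr_eq0 Tk eqxx.
  have [Tl|Tl] := eqVneq (Num.sqrt (Theta l l)) 0.
    rewrite Tl mulr0 (symmx_entry _ _ sT); apply: psdmx_diag_eq0 => //.
    by apply/eqP; rewrite eq_le T0 -sqrtr_eq0 Tl eqxx.
  by field; rewrite Tk Tl.
split=> [|i]; last by rewrite mxE eqxx.
(* the last term restores the unit diagonal where Theta has a null variance *)
pose E : 'M[R]_d := diag_mx (\row_k (Num.sqrt (Theta k k))^-1).
have -> : corr_of Theta =
    E *m Theta *m E^T + diag_mx (\row_k ((Theta k k == 0)%:R)).
  apply/matrixP => k l.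
  rewrite /E tr_diag_mx mxE [in RHS]mxE mul_mx_diag mul_diag_mx !mxE.
  have [<-|kl] := eqVneq k l; last first.
    by rewrite mulr0n addr0 invfM; ring.
  rewrite mulr1n; have [->|Tk] := eqVneq (Theta k k) 0.
    by rewrite mulr0 mul0r add0r.
  by rewrite addr0 mulrAC -invfM -expr2 sqr_sqrtr // mulVf.
apply: psdmxD; first exact: psdmx_congr.
by apply: psdmx_diag => i; rewrite mxE ler0n.
Qed.

Lemma corrmx1 d : corrmx (1%:M : 'M[R]_d).
Proof. by split=> [|i]; [exact: psdmx1|rewrite mxE eqxx]. Qed.

End correlation.

(** * Simultaneous diagonalization by congruence *)

Section simultaneous_diagonalization.
Context {R : realType}.

(** Over the complex numbers the matrix is Hermitian, so it is diagonalizable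
with real eigenvalues. Hence its minimal polynomial divides a product of
distinct linear factors with real roots, and this divisibility descends to the
reals. *)
Lemma symmx_diagonalizable d (A : 'M[R]_d) : A^T = A -> diagonalizable A.
Proof.
case: d A => [|d] A sA.
  by exists 1%:M; rewrite ?unitmx1 //; apply/diagonalizable_forP;
    rewrite ?unitmx1 // => -[].
pose c := real_complex R; pose Ac := map_mx c A.
have hA : Ac \is hermsymmx.
  apply: realsym_hermsym.
    by apply/is_hermitianmxP; rewrite expr0 scale1r map_mx_id // map_trmx sA.
  by apply/mxOverP => i j; rewrite mxE complex_real.
have /hermitian_normalmx/orthomx_spectralP defA := hA.
have /mxOverP rD := hermitian_spectral_diag_real hA.
apply/diagonalizableP.
exists (undup [seq complex.Re (spectral_diag Ac 0 i) | i <- enum 'I_d.+1]).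
  exact: undup_uniq.
rewrite -(dvdp_map c) -mxminpoly_map -/Ac {1}defA.
rewrite -conjVmx ?spectral_unit // mxminpoly_uconj ?unitmx_inv ?spectral_unit //.
rewrite mxminpoly_diag rmorph_prod /=.
have -> : [seq spectral_diag Ac 0 i | i <- enum 'I_d.+1] =
   map c [seq complex.Re (spectral_diag Ac 0 i) | i <- enum 'I_d.+1].
  by rewrite -[RHS]map_comp; apply: eq_map => i /=; rewrite /c RRe_real.
rewrite undup_map_inj; last by move=> x y [].
rewrite big_map [X in _ %| X](eq_bigr (fun x => 'X - (c x)%:P)) ?dvdpp // => x _.
by rewrite map_polyXsubC.
Qed.

(** A Gram-Schmidt process that respects a joint eigenspace decomposition. As
[G] commutes with the matrices [diag_mx (L i)], its entry [(k, l)] can only be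
non-zero when [L i k = L i l] for all [i]; so eliminating with these entries
only combines basis vectors of a same joint eigenspace. *)
Lemma diag_congr_commute d I (G : 'M[R]_d) (L : I -> 'rV[R]_d) :
  G^T = G -> (forall x, x != 0 -> 0 < qform G x) ->
  (forall i, diag_mx (L i) *m G = G *m diag_mx (L i)) ->
  exists W : 'M[R]_d, [/\ W \in unitmx, is_diag_mx (W *m G *m W^T) &
    forall i, W *m diag_mx (L i) = diag_mx (L i) *m W].
Proof.
elim: d G L => [|d IH] G L.
  move=> _ _ _; exists 1%:M; rewrite unitmx1; split=> // [|i].
    by apply/is_diag_mxP => -[].
  by rewrite mul1mx mulmx1.
move: G L; rewrite -[d.+1]/(1 + d)%N => G L sG pG cG.
set g := G ord0 ord0; set b := dlsubmx G; set H := drsubmx G.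
have defG : G = block_mx g%:M b^T b H.
  rewrite -[LHS]submxK; congr block_mx.
    by rewrite [LHS]mx11_scalar; congr (_%:M); rewrite !mxE; congr (G _ _);
      apply: val_inj.
  by rewrite /b trmx_dlsub sG.
have g0 : 0 < g.
  rewrite /g -qform_delta; apply: pG.
  by apply/eqP => /matrixP/(_ ord0 ord0)/eqP; rewrite !mxE !eqxx oner_eq0.
pose l i := L i ord0 (lshift d ord0); pose L' i := rsubmx (L i).
have defL i : diag_mx (L i) = block_mx (l i)%:M 0 0 (diag_mx (L' i)).
  rewrite -[L i in LHS]hsubmxK diag_mx_row; congr block_mx.
  by rewrite [LHS]mx11_scalar !mxE eqxx mulr1n.
have comm i : diag_mx (L' i) *m b = l i *: b /\
    diag_mx (L' i) *m H = H *m diag_mx (L' i).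
  have := cG i; rewrite defG defL !mulmx_block !mul0mx !mulmx0 !addr0 !add0r.
  by move=> /eq_block_mx[_ _ -> ->]; rewrite mul_mx_scalar.
pose w := - g^-1 *: b; pose H' := H - g^-1 *: (b *m b^T).
pose W1 : 'M[R]_(1 + d) := block_mx 1%:M 0 w 1%:M.
have W1G : W1 *m G *m W1^T = block_mx g%:M 0 0 H'.
  rewrite /W1 defG tr_block_mx !mulmx_block !trmx1 !trmx0 !mul1mx !mul0mx.
  rewrite !mulmx1 !mulmx0 !addr0 mul_mx_scalar.
  have -> : g *: w + b = 0.
    by rewrite /w scalerA mulrN divff ?gt_eqF // scaleN1r addNr.
  rewrite mul0mx add0r; congr block_mx.
    rewrite /w linearZ /= mul_scalar_mx scalerA mulrN divff ?gt_eqF //.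
    by rewrite scaleN1r addNr.
  by rewrite /w /H' -scalemxAl scaleNr addrC.
have uW1 : W1 \in unitmx.
  by rewrite unitmxE /W1 det_lblock !det1 mulr1 unitr1.
have [|x x0|i|W [uW dW cW]] := IH H' L'.
- by rewrite /H' linearB /= linearZ /= trmx_mul trmxK /H trmx_drsub sG.
- have -> : qform H' x = qform G (W1^T *m col_mx 0 x).
    rewrite -qform_congr W1G /qform tr_col_mx mul_row_block !mulmx0 !add0r.
    by rewrite trmx0 mul0mx add0r mul_row_col mulmx0 add0r.
  apply: pG; apply: contra_neq x0 => /(congr1 (mulmx (invmx W1^T))).
  rewrite mulKmx ?unitmx_tr // mulmx0 -[0 in RHS]vsubmxK => /eq_col_mx[_ ->].
  by rewrite linear0.
- have [cb cH] := comm i; rewrite /H' mulmxBr mulmxBl cH -scalemxAr -scalemxAl.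
  rewrite mulmxA cb -[b *m b^T *m _]mulmxA.
  have -> : b^T *m diag_mx (L' i) = l i *: b^T.
    by rewrite -[X in _ *m X]tr_diag_mx -trmx_mul cb linearZ.
  by rewrite -scalemxAl -scalemxAr.
exists (block_mx 1%:M 0 0 W *m W1); split.
- by rewrite unitmx_mul uW1 andbT unitmxE det_ublock det1 mul1r -unitmxE.
- have -> : block_mx 1%:M 0 0 W *m W1 *m G *m (block_mx 1%:M 0 0 W *m W1)^T =
      block_mx g%:M 0 0 (W *m H' *m W^T).
    rewrite trmx_mul -!mulmxA [G *m _]mulmxA [W1 *m _]mulmxA.
    rewrite [W1 *m (G *m _)]mulmxA W1G tr_block_mx !mulmx_block !trmx1 !trmx0.
    by rewrite !mul1mx !mul0mx !mulmx1 !mulmx0 !addr0 !add0r mulmxA mulmx0.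
  by rewrite (@is_diag_block_mx _ 1 d 1 d) // !eqxx scalar_mx_is_diag.
- move=> i; have [cb _] := comm i.
  have -> : block_mx 1%:M 0 0 W *m W1 = block_mx 1%:M 0 (W *m w) W.
    by rewrite /W1 mulmx_block !mul1mx !mul0mx !mulmx1 !addr0 !add0r.
  rewrite defL !mulmx_block !mul1mx !mul0mx !mulmx1 !mulmx0 !addr0 !add0r cW.
  rewrite mul_mx_scalar mulmxA -cW -[W *m _ *m w]mulmxA.
  have -> : diag_mx (L' i) *m w = l i *: w.
    by rewrite /w -scalemxAr cb !scalerA mulrC.
  by rewrite -[W *m (_ *: w)]scalemxAr.
Qed.

(** A basis [P] of common eigenvectors exists because the matrices commute and
are diagonalizable. By symmetry, its Gram matrix [P *m P^T] commutes with the
diagonal forms, so [diag_congr_commute] makes the basis orthogonal without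
losing the eigenvectors. *)
Lemma orthogonal_codiagonalization d (As : seq 'M[R]_d) :
  {in As, forall A : 'M[R]_d, A^T = A} -> {in As &, forall A B, comm_mx A B} ->
  exists M : 'M[R]_d, [/\ M \in unitmx, is_diag_mx (M *m M^T) &
    {in As, forall A : 'M[R]_d, exists D, M *m A = diag_mx D *m M}].
Proof.
move=> sA cA.
have /codiagonalizableP[P uP /allP PA] : {in As &, forall A B, comm_mx A B} /\
    {in As, forall A, diagonalizable A}.
  by split=> // A /sA; exact: symmx_diagonalizable.
have /choice[D PD] : forall i : 'I_(size As), exists D : 'rV[R]_d,
    P *m As`_i = diag_mx D *m P.
  move=> i; have /PA/diagonalizable_forPex[D] : As`_i \in As by exact: mem_nth.
  by move=> /(similarP uP) ?; exists D.
have [|||W [uW dW cW]] := @diag_congr_commute d _ (P *m P^T) D.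
- by rewrite trmx_mul trmxK.
- move=> x x0; rewrite qform_gram lt_def sumr_ge0 ?andbT => [|i _]; last first.
    exact: sqr_ge0.
  apply: contra_neq x0 => /eqP; rewrite psumr_eq0 => [/allP z0|i _]; last first.
    exact: sqr_ge0.
  have uPT : P^T \in unitmx by rewrite unitmx_tr.
  rewrite -[x](mulKmx uPT); suff -> : P^T *m x = 0 by rewrite mulmx0.
  apply/matrixP => i j; rewrite [RHS]mxE (ord1 j).
  by have := z0 i (mem_index_enum _) => /= /eqP/eqP; rewrite sqrf_eq0 => /eqP.
- move=> i; have sAi : (As`_i)^T = As`_i by apply: sA; exact: mem_nth.
  rewrite mulmxA -PD -mulmxA -[in LHS]sAi -trmx_mul PD trmx_mul tr_diag_mx.
  by rewrite mulmxA.
exists (W *m P); split.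
- by rewrite unitmx_mul uW.
- by rewrite trmx_mul mulmxA -[W *m P *m P^T]mulmxA.
move=> A AAs; have := AAs; rewrite -index_mem => iA.
have := PD (Ordinal iA); rewrite /= nth_index // => PDA.
by exists (D (Ordinal iA)); rewrite -mulmxA PDA !mulmxA cW.
Qed.

Lemma diag_congr_of_codiag d (M A : 'M[R]_d) D :
  is_diag_mx (M *m M^T) -> M *m A = diag_mx D *m M -> is_diag_mx (M *m A *m M^T).
Proof.
move=> /is_diag_mxP dM ->; apply/is_diag_mxP => k l kl.
by rewrite -mulmxA mul_diag_mx mxE dM // mulr0.
Qed.

End simultaneous_diagonalization.

(** * From (A) to (B), and from (D) to (A) in the four cases *)

Section conditions_A_B_D.
Context {R : realType} (d n : nat) (p : 'I_n -> R).
Context (Sigma : 'M[R]_d) (Sig : 'I_n -> 'M[R]_d).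
Hypothesis hSigma : psdmx Sigma.
Hypothesis hSig : forall i, psdmx (Sig i).
Hypothesis p_ge0 : forall i, 0 <= p i.

(** With [E_i] the diagonal matrix of the standard deviations of [M Sig_i M^*],
the blocks [M^-1 E_i C E_j M^-*] form a coupling [Gamma]: the same normalised
noise, of covariance [C], drives all the components. *)
Lemma condA_condB : condA p Sigma Sig -> condB p Sigma Sig.
Proof.
move=> [M [C [uM [pC _] corC /= SD]]].
pose E i := diag_sqrt (M *m Sig i *m M^T).
pose K : 'M[R]_(\sum_(i < n) d, d) := \mxcol_(i < n) (invmx M *m E i).
set D := diag_mx _ in SD.
have uMT : M^T \in unitmx by rewrite unitmx_tr.
have PK : \mxrow_(i < n) (p i)%:M *m K = invmx M *m D.
  rewrite mul_mxrow_mxcol.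
  transitivity (\sum_i invmx M *m (p i *: E i)).
    by apply: eq_bigr => i _; rewrite mul_scalar_mx scalemxAr.
  rewrite -mulmx_sumr; congr (_ *m _); apply/matrixP => k l.
  rewrite summxE !mxE /mean_std -sumrMnl; apply: eq_bigr => i _.
  by rewrite !mxE mulrnAr.
exists (K *m C *m K^T) => /=; split; first exact: psdmx_congr.
  set P := (\mxrow__ _) in PK *.
  rewrite /loewner_le.
  have -> : P *m (K *m C *m K^T) *m P^T - Sigma =
      invmx M *m (D *m C *m D - M *m Sigma *m M^T) *m (invmx M)^T.
    rewrite mulmxBr mulmxBl; congr (_ - _).
      rewrite !mulmxA PK -mulmxA -trmx_mul PK trmx_mul tr_diag_mx.
      by rewrite !mulmxA.
    by rewrite !mulmxA mulVmx // mul1mx trmx_inv mulmxK.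
  exact: psdmx_congr.
move=> i; rewrite /K tr_mxcol mxcol_mul mul_mxcol_mxrow mxblockK.
have [_ _ corCi] := corC i.
rewrite trmx_mul tr_diag_mx -/(diag_sqrt _) -/(E i) !mulmxA.
rewrite -2!(mulmxA (invmx M)) -corCi trmx_inv !mulmxA mulVmx // mul1mx.
by rewrite mulmxK.
Qed.

Lemma mean_std_ge0 M k : 0 <= mean_std p Sig M k.
Proof. by rewrite sumr_ge0 // => i _; rewrite mulr_ge0 // sqrtr_ge0. Qed.

Section from_D.
Hypothesis hD : condD p Sigma Sig.

Lemma condD_sqr x :
  qform Sigma x <= (\sum_(i < n) p i * Num.sqrt (qform (Sig i) x)) ^+ 2.
Proof.
have [_ pS] := hSigma; rewrite -[leLHS]sqr_sqrtr //.
rewrite ler_sqr ?nnegrE ?sqrtr_ge0 //.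
by rewrite sumr_ge0 // => i _; rewrite mulr_ge0 // sqrtr_ge0.
Qed.

(** (D) at the [k]-th row of [M]. *)
Lemma condD_diag M k : (M *m Sigma *m M^T) k k <= mean_std p Sig M k ^+ 2.
Proof.
rewrite -qform_delta qform_congr (le_trans (condD_sqr _)) //.
rewrite le_eqVlt; apply/orP; left; apply/eqP; congr (_ ^+ 2).
by apply: eq_bigr => i _; rewrite -qform_congr qform_delta.
Qed.

(** Here (D) says that [Sigma <= a^2 Theta] with [a = sum_i p_i sqrt(sigma_i)],
and [a^2 Theta] is exactly [DCD] for [M = 1] and [C] a correlation matrix
associated with [Theta]. *)
Lemma colinear_condA : colinear_family Sig -> condA p Sigma Sig.
Proof.
move=> [T [s [pT s0 defS]]].
have cT := corr_ofP pT; have [pC T0 eT] := cT.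
have sqS i k : Num.sqrt (Sig i k k) = Num.sqrt (s i) * Num.sqrt (T k k).
  by rewrite defS mxE sqrtrM.
exists 1%:M, (corr_of T); split => //.
- exact: unitmx1.
- move=> i; rewrite trmx1 mul1mx mulmx1; split=> //.
    by move=> k; rewrite defS mxE mulr_ge0.
  apply/matrixP => k l; rewrite diag_sqrt_congrE !sqS.
  have /matrixP/(_ k l) := eT; rewrite diag_sqrt_congrE => eTkl.
  rewrite defS mxE [in LHS]eTkl -{1}[s i]sqr_sqrtr //; ring.
rewrite /= trmx1 mul1mx mulmx1.
pose a := \sum_(i < n) p i * Num.sqrt (s i).
have aE k : mean_std p Sig 1%:M k = a * Num.sqrt (T k k).
  rewrite /mean_std trmx1 big_distrl /=; apply: eq_bigr => i _.
  by rewrite mul1mx mulmx1 sqS mulrA.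
have -> : diag_mx (\row_k mean_std p Sig 1%:M k) *m corr_of T *m
    diag_mx (\row_k mean_std p Sig 1%:M k) = a ^+ 2 *: T.
  apply/matrixP => k l; rewrite mul_mx_diag mul_diag_mx !mxE !aE.
  have /matrixP/(_ k l) := eT; rewrite diag_sqrt_congrE => eTkl.
  by rewrite [in RHS]eTkl mxE; ring.
have [sT qT] := pT; have [sS _] := hSigma.
split=> [|x]; first by rewrite linearB linearZ /= sT sS.
rewrite qformB qformZ subr_ge0 (le_trans (condD_sqr _)) //.
rewrite -[X in _ <= _ * X]sqr_sqrtr // -exprMn le_eqVlt; apply/orP; left.
apply/eqP; congr (_ ^+ 2); rewrite /a big_distrl /=; apply: eq_bigr => i _.
by rewrite defS qformZ sqrtrM // mulrA.
Qed.

(** The matrix [Sigma_hat] is [DCD] and differs from [M Sigma M^*] only on the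
diagonal, where [condD_diag] compares them. *)
Lemma common_corr_condA : common_corr p Sigma Sig -> condA p Sigma Sig.
Proof.
move=> [M [C [uM cC corC [_ _ eH]]]]; exists M, C; split=> //=.
have -> : diag_mx (\row_k mean_std p Sig M k) = diag_sqrt (Sigma_hat p Sigma Sig M).
  congr diag_mx; apply/rowP => k; rewrite !mxE eqxx sqrtr_sqr ger0_norm //.
  exact: mean_std_ge0.
rewrite -eH /loewner_le.
have -> : Sigma_hat p Sigma Sig M - M *m Sigma *m M^T =
    diag_mx (\row_k (mean_std p Sig M k ^+ 2 - (M *m Sigma *m M^T) k k)).
  apply/matrixP => k l; rewrite mxE [in RHS]mxE [in X in X + _]mxE [in X in _ + X]mxE.
  have [->|_] := eqVneq k l; first by rewrite mulr1n [in RHS]mxE.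
  by rewrite mulr0n subrr.
by apply: psdmx_diag => k; rewrite mxE subr_ge0 condD_diag.
Qed.

(** After a simultaneous diagonalization, [C = 1] is associated with everything
and the Loewner inequality reduces to its diagonal entries. *)
Lemma commuting_condA : commuting_family Sigma Sig -> condA p Sigma Sig.
Proof.
move=> [N [uN cN cNN]].
pose As := N *m Sigma *m N^T :: [seq N *m Sig i *m N^T | i <- enum 'I_n].
have [||M [uM oM eM]] := @orthogonal_codiagonalization _ d As.
- move=> A; rewrite inE => /orP[/eqP->|/mapP[i _ ->]].
    by have [] := psdmx_congr N hSigma.
  by have [] := psdmx_congr N (hSig i).
- move=> A B; rewrite !inE.
  move=> /orP[/eqP->|/mapP[i _ ->]] /orP[/eqP->|/mapP[j _ ->]] //.
  by apply/esym; exact: cN.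
have dM A : A \in As -> is_diag_mx (M *m A *m M^T).
  by move=> /eM[D]; exact: diag_congr_of_codiag.
have dS : is_diag_mx (M *m N *m Sigma *m (M *m N)^T).
  by rewrite trmx_mul; have := dM _ (mem_head _ _); rewrite !mulmxA.
have dSi i : is_diag_mx (M *m N *m Sig i *m (M *m N)^T).
  have -> : M *m N *m Sig i *m (M *m N)^T = M *m (N *m Sig i *m N^T) *m M^T.
    by rewrite trmx_mul !mulmxA.
  apply: dM; rewrite inE; apply/orP; right; apply/mapP; exists i => //.
  by rewrite mem_enum.
exists (M *m N), 1%:M; split=> /=.
- by rewrite unitmx_mul uM.
- exact: corrmx1.
- move=> i; have pi k := psdmx_diag_ge0 k (psdmx_congr (M *m N) (hSig i)).
  split=> //; first exact: corrmx1.
  apply/matrixP => k l; rewrite diag_sqrt_congrE [1%:M _ _]mxE.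
  have [<-|kl] := eqVneq k l; first by rewrite mulr1 -expr2 sqr_sqrtr.
  by rewrite mulr0 mul0r diag_entry.
rewrite mulmx1 mulmx_diag; apply: loewner_diag => // k.
rewrite [leRHS]mxE; set m := (\row__ _) 0 k.
have -> : m = mean_std p Sig (M *m N) k by rewrite /m mxE.
by rewrite -expr2 condD_diag.
Qed.

(** Let [L_i = M Sig_i M^*], with support projection [E_i], and [S = M Sigma M^*].
The supports are disjoint, so a matrix [C] with unit diagonal is associated with
all the [L_i] as soon as its entries inside each support are those of the
identity; the entries between two distinct supports are free. They are chosen
to agree with [S]: the matrix
[T = S + sum_i (p_i^2 L_i - E_i S E_i)]
coincides with [p_i^2 L_i] on the support of [L_i] and with [S] between two
supports. It dominates [S], because (D) tested on vectors supported by [L_i]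
says that [E_i S E_i <= p_i^2 L_i]; in particular it is positive
semi-definite, and its correlation matrix is the required [C]. *)
Lemma disjoint_diag_condA (M : 'M[R]_d) :
  M \in unitmx -> (forall i, is_diag_mx (M *m Sig i *m M^T)) ->
  (forall i j k, i != j ->
     (M *m Sig i *m M^T) k k * (M *m Sig j *m M^T) k k = 0) ->
  condA p Sigma Sig.
Proof.
move=> uM dL disj.
pose L i := M *m Sig i *m M^T; pose S := M *m Sigma *m M^T.
pose e i k : R := (L i k k != 0)%:R.
pose E i : 'M[R]_d := diag_mx (\row_k e i k).
have pL i : psdmx (L i) := psdmx_congr M (hSig i).
have pS : psdmx S := psdmx_congr M hSigma.
have L0 i k : 0 <= L i k k by exact: psdmx_diag_ge0.
have LE i : L i = diag_mx (\row_k L i k k).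
  apply/matrixP => k l; rewrite [RHS]mxE [X in X *+ _]mxE.
  have [->|kl] := eqVneq k l; first by rewrite mulr1n.
  by rewrite mulr0n diag_entry // /L.
have qL i x : qform (L i) x = \sum_k L i k k * x k ord0 ^+ 2.
  by rewrite [in LHS]LE qform_diag; apply: eq_bigr => k _; rewrite mxE.
have Ex i x k : (E i *m x) k ord0 = e i k * x k ord0 :> R.
  by rewrite /E mul_diag_mx !mxE.
have eL i j k : i != j -> e i k != 0 -> L j k k = 0.
  rewrite /e => ij; case: (eqVneq (L i k k) 0) => [_|Lik _] /=.
    by rewrite eqxx.
  by apply/eqP; have /eqP := disj _ _ k ij; rewrite mulf_eq0 (negbTE Lik).
pose U i := p i ^+ 2 *: L i - E i *m S *m (E i)^T.
have pU i : psdmx (U i).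
  split=> [|x].
    have [sL _] := pL i; have [sES _] := psdmx_congr (E i) pS.
    by rewrite /U linearB linearZ /= sL sES.
  rewrite qformB qformZ qform_congr subr_ge0 tr_diag_mx -/(E i).
  rewrite /S qform_congr (le_trans (condD_sqr _)) //.
  rewrite (bigD1 i) //= big1 ?addr0 => [|j ji]; last first.
    rewrite -qform_congr -/(L j) qL big1 ?sqrtr0 ?mulr0 // => k _.
    rewrite Ex; have [->|ek] := eqVneq (e i k) 0.
      by rewrite mul0r expr0n mulr0.
    by rewrite (eL i) ?mul0r // eq_sym.
  rewrite -qform_congr -/(L i) exprMn sqr_sqrtr; last by have [_] := pL i.
  rewrite ler_wpM2l ?sqr_ge0 // !qL ler_sum // => k _; rewrite Ex /e.
  by have [->|_] := eqVneq (L i k k) 0; rewrite ?mul0r // mul1r.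
pose T := S + \sum_i U i.
have pT : psdmx T by apply: psdmxD => //; exact: psdmx_sum.
have TE k l : T k l = S k l +
    \sum_i (p i ^+ 2 * L i k l - e i k * S k l * e i l).
  rewrite mxE summxE; congr (_ + _); apply: eq_bigr => i _.
  rewrite /U /E tr_diag_mx mxE [in LHS]mxE [X in _ + X]mxE mul_mx_diag.
  by rewrite [X in _ - X]mxE mul_diag_mx [X in _ - X * _]mxE !mxE.
have TE1 i k l : e i k != 0 -> e i l != 0 -> T k l = p i ^+ 2 * L i k l.
  move=> eik eil; have e1 k' : e i k' != 0 -> e i k' = 1.
    by rewrite /e; case: (L i k' k' != 0); rewrite //= eqxx.
  rewrite TE (bigD1 i) //= big1 ?addr0 => [|j ji]; last first.
    have Lk : L j k k = 0 by apply: (eL i) => //; rewrite eq_sym.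
    have Lkl : L j k l = 0 by exact: psdmx_diag_eq0.
    by rewrite Lkl /e Lk eqxx mulr0 !mul0r subr0.
  by rewrite (e1 k eik) (e1 l eil) mul1r mulr1 addrC subrK.
(* outside all the supports, (D) forces the variance S k k to vanish *)
have mE k : mean_std p Sig M k ^+ 2 = T k k.
  have [/existsP[i eik]|/existsPn e0] := boolP [exists i, e i k != 0].
    rewrite (TE1 i) // /mean_std (bigD1 i) //= big1 ?addr0 => [|j ji].
      by rewrite exprMn sqr_sqrtr //; exact: L0.
    by rewrite -/(L j) (eL i) ?sqrtr0 ?mulr0 // eq_sym.
  have L00 i : L i k k = 0.
    have := e0 i; rewrite negbK /e.
    by case: (eqVneq (L i k k) 0) => //= _; rewrite oner_eq0.
  have m0 : mean_std p Sig M k = 0.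
    by rewrite /mean_std big1 // => i _; rewrite -/(L i) L00 sqrtr0 mulr0.
  have Sk : S k k = 0.
    apply/eqP; rewrite eq_le psdmx_diag_ge0 // andbT.
    by have := condD_diag M k; rewrite m0 expr0n.
  rewrite m0 expr0n TE Sk big1 ?addr0 // => i _.
  by rewrite L00 !(mulr0, mul0r) subr0.
have [cC _ eT] := corr_ofP pT.
exists M, (corr_of T); split=> //=.
  move=> i; split=> //; first by move=> k; exact: L0.
  apply/matrixP => k l; rewrite diag_sqrt_congrE -/(L i).
  have [<-|kl] := eqVneq k l.
    by have [_ ->] := cC; rewrite mulr1 -expr2 sqr_sqrtr.
  rewrite [LHS](diag_entry (dL i : is_diag_mx (L i)) kl).
  have [->|Lk] := eqVneq (L i k k) 0; first by rewrite sqrtr0 !mul0r.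
  have [->|Ll] := eqVneq (L i l l) 0; first by rewrite sqrtr0 mulr0.
  have e0 k' : L i k' k' != 0 -> e i k' != 0 by rewrite /e => ->; exact: oner_neq0.
  rewrite [corr_of _ _ _]mxE (negbTE kl) (TE1 i) ?e0 //.
  by rewrite (diag_entry (dL i : is_diag_mx (L i)) kl) !(mulr0, mul0r).
have -> : diag_mx (\row_k mean_std p Sig M k) = diag_sqrt T.
  congr diag_mx; apply/rowP => k; rewrite [LHS]mxE [RHS]mxE -mE sqrtr_sqr.
  by rewrite ger0_norm // mean_std_ge0.
rewrite -eT /loewner_le /T addrC addKr.
exact: psdmx_sum.
Qed.

(** The matrices [N Sig_i N^*] annihilate each other, hence commute; in a common
orthogonal eigenbasis their diagonal forms have disjoint supports. *)
Lemma orthogonal_condA : orthogonal_family Sig -> condA p Sigma Sig.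
Proof.
move=> [N uN oN].
pose As := [seq N *m Sig i *m N^T | i <- enum 'I_n].
have mem i : N *m Sig i *m N^T \in As by apply/mapP; exists i; rewrite ?mem_enum.
have [||M [uM oM eM]] := @orthogonal_codiagonalization _ d As.
- by move=> A /mapP[i _ ->]; have [] := psdmx_congr N (hSig i).
- move=> A B /mapP[i _ ->] /mapP[j _ ->]; have [->//|ij] := eqVneq i j.
  by rewrite /comm_mx !oN // eq_sym.
have /choice[D eD] i : exists D : 'rV_d, M *m (N *m Sig i *m N^T) = diag_mx D *m M.
  exact: eM (mem i).
have MNE i : M *m N *m Sig i *m (M *m N)^T = M *m (N *m Sig i *m N^T) *m M^T.
  by rewrite trmx_mul !mulmxA.
apply: (@disjoint_diag_condA (M *m N)).
- by rewrite unitmx_mul uM.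
- by move=> i; rewrite MNE; exact: diag_congr_of_codiag oM (eD i).
move=> i j k ij; rewrite !MNE !eD -!mulmxA !mul_diag_mx !mxE.
suff : D i ord0 k * D j ord0 k = 0.
  by move=> DD; rewrite mulrACA DD mul0r.
have : diag_mx (D i) *m diag_mx (D j) = 0.
  have := oN i j ij; move: (eD i) (eD j).
  move: (N *m Sig i *m N^T) (N *m Sig j *m N^T) => Si Sj ei ej SS.
  rewrite -[LHS](mulmxK uM) -[_ *m M]mulmxA -ej mulmxA -ei -(mulmxA M) SS.
  by rewrite mulmx0 mul0mx.
by move=> /matrixP/(_ k k); rewrite mulmx_diag !mxE eqxx.
Qed.

End from_D.
End conditions_A_B_D.

(** * Convex functions on a finite-dimensional space *)

Section convex_functions.
Context {R : realType} (d : nat) (phi : 'cV[R]_d -> R).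
Hypothesis phi_convex : convex_function [set: convex_lmodType 'cV[R]_d]%classic phi.

Lemma convex_segment (t : R) (x y : 'cV[R]_d) : 0 <= t -> t <= 1 ->
  phi (t *: x + (1 - t) *: y) <= t * phi x + (1 - t) * phi y.
Proof. by move=> t0 t1; exact: (phi_convex (Itv01 t0 t1) (in_setT x) (in_setT y)). Qed.

Lemma convex_two_points (c q : R) (x y : 'cV[R]_d) :
  0 <= c -> 0 <= q -> 0 < c + q ->
  (c + q) * phi ((c + q)^-1 *: (c *: y + q *: x)) <= c * phi y + q * phi x.
Proof.
move=> c0 q0 cq; have cqn : c + q != 0 by rewrite gt_eqF.
have t1 : 1 - c / (c + q) = q / (c + q) by field.
have := @convex_segment (c / (c + q)) y x; rewrite t1.
rewrite divr_ge0 ?(ltW cq) // ler_pdivrMr // mul1r lerDl => /(_ isT q0).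
rewrite -(ler_pM2l cq) scalerDr !scalerA ![_^-1 * _]mulrC => /le_trans; apply.
by rewrite le_eqVlt; apply/orP; left; apply/eqP; field.
Qed.

(** The extra point [y] of weight [c] lets the induction absorb the points of
the list one after the other without ever dividing by a zero weight. *)
Lemma convex_jensen I (r : seq I) (q : I -> R) (x : I -> 'cV[R]_d) (c : R) y :
  0 <= c -> (forall i, 0 <= q i) -> 0 < c + \sum_(i <- r) q i ->
  (c + \sum_(i <- r) q i) *
    phi ((c + \sum_(i <- r) q i)^-1 *: (c *: y + \sum_(i <- r) q i *: x i))
    <= c * phi y + \sum_(i <- r) q i * phi (x i).
Proof.
move=> + q0; elim: r c y => [|a r IH] c y c0.
  by rewrite !big_nil !addr0 => cp; rewrite scalerA mulVf ?scale1r // gt_eqF.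
rewrite !big_cons !addrA => cS.
have [cq|cq] := ltP 0 (c + q a).
  apply: le_trans (lerD (convex_two_points (x a) y c0 (q0 a) cq) (lexx _)).
  have := IH (c + q a) ((c + q a)^-1 *: (c *: y + q a *: x a)) (ltW cq) cS.
  by rewrite scalerA divff ?scale1r // gt_eqF.
have qa0 : q a = 0 by apply/eqP; rewrite eq_le q0 andbT; have := q0 a; lra.
have c00 : c = 0 by lra.
move: cS; rewrite qa0 c00 !scale0r !mul0r !add0r => cS.
by have := IH 0 y (lexx _); rewrite scale0r mul0r !add0r => /(_ cS).
Qed.

Lemma convex_jensen_fin (I : finType) (q : I -> R) (x : I -> 'cV[R]_d) :
  (forall i, 0 <= q i) -> \sum_i q i = 1 ->
  phi (\sum_i q i *: x i) <= \sum_i q i * phi (x i).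
Proof.
move=> q0 q1; have := @convex_jensen I (index_enum I) q x 0 0 (lexx _) q0.
by rewrite scaler0 mul0r !add0r q1 invr1 scale1r mul1r ltr01 => /(_ isT).
Qed.

(** Write [a] as a barycentre of [a + u], with weight 1, and of the points
[a - sg(u_i) e_i], with weights [|u_i|], and apply Jensen's inequality. *)
Lemma convex_lower_bound (a : 'cV[R]_d) : exists2 C, 0 <= C &
  forall u : 'cV[R]_d, phi a - C * (\sum_i `|u i ord0|) <= phi (a + u).
Proof.
pose e i : 'cV[R]_d := delta_mx i ord0.
pose C := \sum_i (`|phi (a - e i)| + `|phi a| + `|phi (a + e i)|) + `|phi a|.
have C0 : 0 <= C by rewrite addr_ge0 // sumr_ge0 // => i _; rewrite !addr_ge0.
exists (C + `|phi a|) => [|u]; first by rewrite addr_ge0.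
pose t := \sum_i `|u i ord0|; rewrite -/t.
have t0 : 0 <= t by rewrite sumr_ge0.
pose y i := a - Num.sg (u i ord0) *: e i.
have yC i : phi (y i) <= C.
  rewrite /C (bigD1 i) //= -addrA.
  have r0 : 0 <= \sum_(j | j != i) (`|phi (a - e j)| + `|phi a| + `|phi (a + e j)|).
    by rewrite sumr_ge0 // => j _; rewrite !addr_ge0.
  have := (normr_ge0 (phi a), normr_ge0 (phi (a - e i)), normr_ge0 (phi (a + e i))).
  move=> [[h1 h2] h3]; have := ler_norm (phi (y i)); rewrite /y.
  case: sgrP => _.
  - by rewrite scale0r subr0; lra.
  - by rewrite scale1r; lra.
  - by rewrite scaleN1r opprK; lra.
have := @convex_jensen 'I_d (index_enum _) (fun i => `|u i ord0|) y 1 (a + u) ler01.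
move=> /(_ (fun i => normr_ge0 _)); rewrite -/t => J.
have : 0 < 1 + t by rewrite ltr_wpDr.
move=> t1; have := J t1.
have -> : 1 *: (a + u) + \sum_i `|u i ord0| *: y i = (1 + t) *: a.
  rewrite scale1r scalerDl scale1r -addrA; congr (_ + _).
  have -> : t *: a = \sum_i `|u i ord0| *: a by rewrite scaler_suml.
  apply/eqP; rewrite eq_sym -subr_eq; apply/eqP.
  rewrite -sumrB; apply/colP => k; rewrite summxE (bigD1 k) //= big1 => [|i ik].
    by rewrite addr0 -scalerBr /y subKr !mxE !eqxx mulr1 mulrC -numEsg.
  by rewrite -scalerBr /y subKr !mxE [k == i]eq_sym (negbTE ik) /= !mulr0.
rewrite scalerA mulVf ?gt_eqF // scale1r mul1r.
have : \sum_i `|u i ord0| * phi (y i) <= t * C.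
  by rewrite big_distrl /=; apply: ler_sum => i _; rewrite ler_wpM2l.
move=> h1 h2.
have := ler_norm (phi a); have := ler_norm (- phi a); rewrite normrN => h3 h4.
have : - (t * `|phi a|) <= t * phi a by rewrite -mulrN ler_wpM2l //; lra.
nra.
Qed.

End convex_functions.

Section convex_measurable.
Local Open Scope classical_set_scope.
Context {R : realType} (d : nat) (phi : 'cV[R]_d -> R).
Hypothesis phi_convex : convex_function [set: convex_lmodType 'cV[R]_d] phi.

(** By [convex_lower_bound], a convex function is lower semicontinuous. *)
Lemma convex_open_gt c : open [set x | c < phi x].
Proof.
rewrite openE => a /= ca; have [C C0 lb] := convex_lower_bound phi_convex a.
pose D := C * d%:R + 1; have D0 : 0 < D by rewrite ltr_wpDl // mulr_ge0.
apply/nbhs_ballP; exists ((phi a - c) / D) => /=; first by rewrite divr_gt0 // subr_gt0.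
move=> x [_ ax] /=.
have -> : x = a + (x - a) by rewrite addrC subrK.
apply: lt_le_trans (lb _).
have : C * (\sum_i `|(x - a) i ord0|) <= C * (d%:R * ((phi a - c) / D)).
  rewrite ler_wpM2l // -[d in d%:R]card_ord mulr_natl -sumr_const ler_sum // => i _.
  by have := ax i ord0; rewrite /ball /= distrC !mxE => /ltW.
suff : C * (d%:R * ((phi a - c) / D)) < phi a - c by lra.
have -> : C * (d%:R * ((phi a - c) / D)) = (C * d%:R) * (phi a - c) / D by ring.
rewrite ltr_pdivrMr // mulrC ltr_pM2l ?subr_gt0 // /D; lra.
Qed.

Lemma measurable_convex : measurable_fun setT (phi : borelRd R d -> R).
Proof.
apply: (measurability _ (RGenOInfty.measurableE R)) => //.
move=> _ [_ [c ->] <-]; rewrite setTI; apply: sub_sigma_algebra.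
rewrite (_ : _ @^-1` _ = [set x | c < phi x]); first exact: convex_open_gt.
by apply/seteqP; split=> x /=; rewrite in_itv /= andbT.
Qed.

End convex_measurable.

(** * Integration against a normal law *)

Section normal.
Local Open Scope classical_set_scope.
Local Open Scope ereal_scope.
Context {R : realType}.
Local Notation mu := (@lebesgue_measure R).
Local Notation T := (measurableTypeR R).
Import HBNNSimple.

Lemma normal_probE (m s : R) (A : set T) : measurable A ->
  normal_prob m s A = \int[mu]_x ((\1_A x)%:E * (normal_pdf m s x)%:E).
Proof.
move=> mA; rewrite /normal_prob integral_mkcond; apply: eq_integral => x _.
by rewrite patchE indicE; case: ifPn => _; rewrite ?mul1e ?mul0e.
Qed.

(** By linearity and monotone convergence, from the case of indicators, which is
the definition of the law. *)
Lemma ge0_integral_normal_prob (m s : R) (f : T -> \bar R) :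
  measurable_fun setT f -> (forall x, 0 <= f x) ->
  \int[normal_prob m s]_x f x = \int[mu]_x (f x * (normal_pdf m s x)%:E).
Proof.
move=> mf f0; pose f_ := nnsfun_approx measurableT mf.
have pdf0 x : 0 <= (normal_pdf m s x)%:E by rewrite lee_fin normal_pdf_ge0.
have mpdf : measurable_fun setT (fun x : T => (normal_pdf m s x)%:E).
  by apply/measurable_EFinP; exact: measurable_normal_pdf.
transitivity (limn (fun n => \int[normal_prob m s]_x (f_ n x)%:E)).
  rewrite -monotone_convergence//.
  - by apply: eq_integral => y _; apply/esym/cvg_lim => //; exact: cvg_nnsfun_approx.
  - by move=> n; exact/measurable_EFinP/measurable_funP.
  - by move=> n y _; rewrite lee_fin.
  - by move=> y _ a b ab; rewrite lee_fin; exact/lefP/nd_nnsfun_approx.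
rewrite [X in limn X](_ : _ =
    (fun n => \int[mu]_x ((f_ n x)%:E * (normal_pdf m s x)%:E))).
  rewrite -monotone_convergence//.
  - apply: eq_integral => x _; apply/cvg_lim => //.
    by apply: cvgeZr => //; exact: cvg_nnsfun_approx.
  - by move=> n; apply: emeasurable_funM => //; exact/measurable_EFinP/measurable_funP.
  - by move=> n y _; apply: mule_ge0; [rewrite lee_fin|exact: pdf0].
  - move=> y _ a b ab; rewrite lee_wpmul2r ?lee_fin //.
      exact: normal_pdf_ge0.
    exact/lefP/nd_nnsfun_approx.
apply/funext => n.
transitivity (\sum_(k \in range (f_ n))
    \int[normal_prob m s]_x (k * \1_(f_ n @^-1` [set k]) x)%:E).
  under eq_integral do rewrite fimfunE -fsumEFin//.
  rewrite ge0_integral_fsum//.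
  - by move=> y; exact/measurable_EFinP/measurable_funM.
  - by move=> y x _; rewrite nnfun_muleindic_ge0.
transitivity (\sum_(k \in range (f_ n))
    \int[mu]_x ((k * \1_(f_ n @^-1` [set k]) x)%:E * (normal_pdf m s x)%:E)).
  apply: eq_fsbigr => r /set_mem [x0 _ <-].
  rewrite integralZl_indic_nnsfun// integral_indic// setIT.
  rewrite [X in _ * X = _](@normal_probE m s) //.
  under [RHS]eq_integral do rewrite EFinM -muleA.
  rewrite ge0_integralZl//.
  - apply: emeasurable_funM => //; exact/measurable_EFinP.
  - by move=> x _; rewrite mule_ge0 // lee_fin.
  - by rewrite lee_fin.
rewrite -ge0_integral_fsum//.
- apply: eq_integral => x _; rewrite [in RHS]fimfunE -fsumEFin//.
  rewrite ge0_mule_fsuml //.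
  by move=> r; rewrite nnfun_muleindic_ge0.
- move=> r; apply: emeasurable_funM => //; exact/measurable_EFinP/measurable_funM.
- by move=> r x _; rewrite mule_ge0 // nnfun_muleindic_ge0.
Qed.

(** The image of the Lebesgue measure by a translation gives the same mass to
intervals, hence is the Lebesgue measure. *)
Lemma ge0_lebesgue_integral_shift (f : R -> \bar R) (t : R) :
  measurable_fun setT f -> (forall x, 0 <= f x) ->
  \int[mu]_x f (x + t)%R = \int[mu]_x f x.
Proof.
move=> mf f0.
have mt : measurable_fun setT ((fun x => x + t)%R : T -> T).
  by apply: measurable_funD.
transitivity (\int[pushforward mu ((fun x => x + t)%R : T -> T)]_x f x).
  by rewrite ge0_integral_pushforward.
apply: eq_measure_integral => //= A mA _.
apply/esym/lebesgue_measure_unique => //= _ [[a b]] _ <-.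
rewrite /pushforward.
have -> : (fun x => x + t)%R @^-1` `]a, b]%classic = `](a - t)%R, (b - t)%R]%classic.
  by apply/seteqP; split=> x /=; rewrite !in_itv/= ltrBlDr lerBrDr.
rewrite !lebesgue_measure_itv/= !lte_fin ltrD2r.
by case: ifP => // _; rewrite -!EFinB opprD opprK addrACA addNr addr0.
Qed.

End normal.

(** * Rotation invariance of the plane normal law *)

Section rotation_plane.
Local Open Scope classical_set_scope.
Local Open Scope ereal_scope.
Context {R : realType}.
Local Notation mu := (@lebesgue_measure R).
Local Notation T := (measurableTypeR R).
Implicit Types f : (T * T)%type -> \bar R.

Lemma measurable_lincomb (a b : R) :
  measurable_fun setT (fun z : (T * T)%type => (a * z.1 + b * z.2)%R : T).
Proof. by apply: measurable_funD; apply: measurable_funM. Qed.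

Lemma measurable_linear2 (a b c d : R) :
  measurable_fun setT (fun z : (T * T)%type =>
    ((a * z.1 + b * z.2)%R : T, (c * z.1 + d * z.2)%R : T)).
Proof. by apply/measurable_fun_pair; exact: measurable_lincomb. Qed.

Lemma lebesgue2_shear1 f (t : R) : measurable_fun setT f -> (forall z, 0 <= f z) ->
  \int[mu]_x \int[mu]_y f ((x + t * y)%R, y) = \int[mu]_x \int[mu]_y f (x, y).
Proof.
move=> mf f0; pose g z := f ((z.1 + t * z.2)%R, z.2).
have mg : measurable_fun setT (g : T * T -> _).
  apply: measurableT_comp => //; apply/measurable_fun_pair => //.
  by apply: measurable_funD => //; apply: measurable_funM.
have g0 z : 0 <= g z by exact: f0.
transitivity (\int[mu]_y \int[mu]_x g (x, y)).
  exact: (@fubini_tonelli _ _ T T R mu mu g mg g0).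
transitivity (\int[mu]_y \int[mu]_x f (x, y)); last first.
  exact/esym/(@fubini_tonelli _ _ T T R mu mu f mf f0).
apply: eq_integral => y _.
apply: (@ge0_lebesgue_integral_shift _ (fun x => f (x, y)) (t * y)%R) => //.
exact: measurableT_comp.
Qed.

Lemma lebesgue2_shear2 f (t : R) : measurable_fun setT f -> (forall z, 0 <= f z) ->
  \int[mu]_x \int[mu]_y f (x, (y + t * x)%R) = \int[mu]_x \int[mu]_y f (x, y).
Proof.
move=> mf f0; apply: eq_integral => x _.
apply: (@ge0_lebesgue_integral_shift _ (fun y => f (x, y)) (t * x)%R) => //.
exact: measurableT_comp.
Qed.

(** A rotation is a product of three shears,
[(1 t; 0 1) (1 0; s 1) (1 t; 0 1)] with [t = - s / (1 + c)], and each of them is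
a translation in one coordinate when the other one is frozen. The hypothesis
[0 <= c] keeps [1 + c] away from zero. *)
Lemma lebesgue2_rotation f (c s : R) : (c ^+ 2 + s ^+ 2 = 1)%R -> (0 <= c)%R ->
  measurable_fun setT f -> (forall z, 0 <= f z) ->
  \int[mu]_x \int[mu]_y f ((c * x - s * y)%R, (s * x + c * y)%R) =
  \int[mu]_x \int[mu]_y f (x, y).
Proof.
move=> cs c0 mf f0; pose t := (- s / (1 + c))%R.
have c1 : (1 + c != 0)%R by rewrite gt_eqF // ltr_pwDl.
have tc : (t * (1 + c) = - s)%R by rewrite /t divfK.
have ts : (1 + t * s = c)%R.
  apply: (mulIf c1); rewrite mulrDl mul1r mulrAC tc; nra.
pose g1 z := f ((z.1 + t * z.2)%R, z.2); pose g2 z := g1 (z.1, (z.2 + s * z.1)%R).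
have mg1 : measurable_fun setT (g1 : T * T -> _).
  apply: measurableT_comp => //; apply/measurable_fun_pair => //.
  by apply: measurable_funD => //; apply: measurable_funM.
have mg2 : measurable_fun setT (g2 : T * T -> _).
  apply: measurableT_comp => //; apply/measurable_fun_pair => //.
  by apply: measurable_funD => //; apply: measurable_funM.
transitivity (\int[mu]_x \int[mu]_y g2 ((x + t * y)%R, y)).
  apply: eq_integral => x _; apply: eq_integral => y _; rewrite /g2 /g1 /=.
  have -> : (y + s * (x + t * y) = s * x + c * y)%R by rewrite -ts; ring.
  congr (f (_, _)); rewrite -[X in (_ - X * y)%R]opprK -tc -ts; ring.
transitivity (\int[mu]_x \int[mu]_y g2 (x, y)).
  by apply: lebesgue2_shear1 => // z; exact: f0.
transitivity (\int[mu]_x \int[mu]_y g1 (x, y)).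
  by apply: (@lebesgue2_shear2 g1 s) => // z; exact: f0.
exact: lebesgue2_shear1.
Qed.

Local Notation N := (normal_prob (0:R) 1).
Local Notation pdf := (normal_pdf (0:R) 1).

Lemma normal_pdf_prod x y :
  (pdf x * pdf y)%R = ((normal_peak 1) ^+ 2 * expR (- (x ^+ 2 + y ^+ 2) / 2))%R.
Proof.
rewrite !normal_pdfE ?oner_eq0 // /normal_fun !subr0 expr1n.
by rewrite mulrACA -expr2 -expRD -mulrDl -opprD.
Qed.

Lemma normal2_density f : measurable_fun setT f -> (forall z, 0 <= f z) ->
  \int[N]_x \int[N]_y f (x, y) =
  \int[mu]_x \int[mu]_y (f (x, y) * (pdf x * pdf y)%:E).
Proof.
move=> mf f0.
have mpdf : measurable_fun setT (fun x : T => (pdf x)%:E).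
  by apply/measurable_EFinP; exact: measurable_normal_pdf.
have pdf0 x : 0 <= (pdf x)%:E by rewrite lee_fin normal_pdf_ge0.
rewrite ge0_integral_normal_prob; last 2 first.
- exact: (@measurable_fun_fubini_tonelli_F _ _ T T R N).
- by move=> x; exact: integral_ge0.
apply: eq_integral => x _; rewrite ge0_integral_normal_prob //; last first.
  exact: measurableT_comp.
rewrite -ge0_integralZr //.
- by apply: eq_integral => y _; rewrite EFinM -muleA (muleC (pdf y)%:E).
- by apply: emeasurable_funM => //; exact: measurableT_comp.
- by move=> y _; rewrite mule_ge0.
Qed.

(** The product density only depends on [x ^+ 2 + y ^+ 2]. *)
Lemma normal2_rotation f (c s : R) : (c ^+ 2 + s ^+ 2 = 1)%R -> (0 <= c)%R ->
  measurable_fun setT f -> (forall z, 0 <= f z) ->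
  \int[N]_x \int[N]_y f ((c * x - s * y)%R, (s * x + c * y)%R) =
  \int[N]_x \int[N]_y f (x, y).
Proof.
move=> cs c0 mf f0.
have mrot : measurable_fun setT (fun z : T * T =>
    f ((c * z.1 - s * z.2)%R, (s * z.1 + c * z.2)%R)).
  apply: measurableT_comp => //.
  under eq_fun do rewrite -mulNr.
  exact: measurable_linear2.
rewrite [RHS](@normal2_density f mf f0).
pose h z := f z * (pdf z.1 * pdf z.2)%:E.
transitivity (\int[mu]_x \int[mu]_y h ((c * x - s * y)%R, (s * x + c * y)%R)).
  rewrite (@normal2_density (fun z =>
    f ((c * z.1 - s * z.2)%R, (s * z.1 + c * z.2)%R)) mrot (fun z => f0 _)).
  apply: eq_integral => x _; apply: eq_integral => y _; rewrite /h /=.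
  congr (_ * _%:E); rewrite (normal_pdf_prod x y) (normal_pdf_prod (c * x - s * y)).
  suff -> : ((c * x - s * y) ^+ 2 + (s * x + c * y) ^+ 2 = x ^+ 2 + y ^+ 2)%R by [].
  transitivity ((c ^+ 2 + s ^+ 2) * (x ^+ 2 + y ^+ 2))%R; first by ring.
  by rewrite cs mul1r.
apply: (@lebesgue2_rotation h c s) => //.
- apply: emeasurable_funM => //; apply/measurable_EFinP.
  by apply: measurable_funM; apply: measurableT_comp => //; exact: measurable_normal_pdf.
- by move=> z; rewrite mule_ge0 // lee_fin mulr_ge0 // normal_pdf_ge0.
Qed.

End rotation_plane.

(** * Orthogonal maps preserving the standard Gaussian law *)

Section rotation_invariance.
Local Open Scope classical_set_scope.
Local Open Scope ereal_scope.
Context {R : realType}.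
Local Notation N := (normal_prob (0:R) 1).
Local Notation gam d := (@std_gaussian R d).

Definition linRd m d (K : 'M[R]_(d, m)) (z : borelRd R m) : borelRd R d :=
  K *m (z : 'cV[R]_m).

Lemma measurable_linRd m d (K : 'M[R]_(d, m)) : measurable_fun setT (linRd K).
Proof.
apply: measurable_borelRdP => i; rewrite /linRd.
under eq_fun do rewrite mxE.
apply: measurable_sum => j.
by apply: measurable_funM => //; exact: measurable_coordRd.
Qed.

Lemma linRdM m d k (K : 'M[R]_(d, m)) (L : 'M[R]_(k, d)) z :
  linRd (L *m K) z = linRd L (linRd K z).
Proof. by rewrite /linRd mulmxA. Qed.

Lemma linRd1 m z : linRd (1%:M : 'M[R]_m) z = z.
Proof. by rewrite /linRd mul1mx. Qed.

Lemma std_gaussianS d (f : borelRd R d.+1 -> \bar R) :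
  measurable_fun setT f -> (forall z, 0 <= f z) ->
  \int[gam d.+1]_z f z = \int[N]_x \int[gam d]_z f (consRd (x, z)).
Proof.
move=> mf f0; rewrite ge0_integral_distribution //.
rewrite (@fubini_tonelli1 _ _ _ _ _ N (gam d)) //.
  by apply: measurableT_comp => //; exact: measurable_consRd.
by move=> x; exact: f0.
Qed.

Lemma ge0_lebesgue_integralN (f : R -> \bar R) :
  measurable_fun setT f -> (forall x, 0 <= f x) ->
  \int[lebesgue_measure]_x f (- x)%R = \int[lebesgue_measure]_x f x.
Proof.
move=> mf f0.
transitivity (\int[pushforward lebesgue_measure (-%R : _ -> measurableTypeR R)]_x f x).
  by rewrite ge0_integral_pushforward.
by apply: eq_measure_integral => A mA _; exact: lebesgue_measureN.
Qed.

Lemma normal_integralN (f : measurableTypeR R -> \bar R) :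
  measurable_fun setT f -> (forall x, 0 <= f x) ->
  \int[N]_x f (- x)%R = \int[N]_x f x.
Proof.
move=> mf f0.
have mfN : measurable_fun setT (fun x : measurableTypeR R => f (- x)%R).
  by apply: measurableT_comp.
rewrite (ge0_integral_normal_prob _ _ mfN) // (ge0_integral_normal_prob _ _ mf) //.
rewrite -[RHS]ge0_lebesgue_integralN.
- apply: eq_integral => x _; congr (_ * _%:E).
  by rewrite !normal_pdfE ?oner_eq0 // /normal_fun !subr0 sqrrN.
- apply: emeasurable_funM => //; apply/measurable_EFinP.
  exact: measurable_normal_pdf.
- by move=> x; rewrite mule_ge0 // lee_fin normal_pdf_ge0.
Qed.

(** The first two coordinates are integrated first, the others being frozen, so
that plane results apply to them. *)
Lemma std_gaussianSS d (f : borelRd R d.+2 -> \bar R) :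
  measurable_fun setT f -> (forall z, 0 <= f z) ->
  \int[gam d.+2]_z f z =
  \int[gam d]_z \int[N]_x \int[N]_y f (consRd (x, consRd (y, z))).
Proof.
move=> mf f0; rewrite std_gaussianS //.
have mg : measurable_fun setT (fun t : (measurableTypeR R * borelRd R d) *
    measurableTypeR R => f (consRd (t.1.1, consRd (t.2, t.1.2)))).
  apply: measurableT_comp => //; apply: measurableT_comp; first exact: measurable_consRd.
  apply/measurable_fun_pair; first exact: measurableT_comp.
  apply: measurableT_comp; first exact: measurable_consRd.
  by apply/measurable_fun_pair => //; exact: measurableT_comp.
have mG := @measurable_fun_fubini_tonelli_F _ _ _ _ _ N _ mg (fun z => f0 _).
transitivity (\int[N]_x \int[gam d]_z \int[N]_y f (consRd (x, consRd (y, z)))).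
  apply: eq_integral => x _; rewrite std_gaussianS //; last first.
    apply: measurableT_comp => //; apply: measurableT_comp; first exact: measurable_consRd.
    exact/measurable_fun_pair.
  have mh : measurable_fun setT (fun t : measurableTypeR R * borelRd R d =>
      f (consRd (x, consRd t))).
    apply: measurableT_comp => //; apply: measurableT_comp; first exact: measurable_consRd.
    apply/measurable_fun_pair => //; exact: measurable_consRd.
  exact: (@fubini_tonelli _ _ _ _ _ N (gam d) _ mh (fun z => f0 _)).
apply: (@fubini_tonelli _ _ _ _ _ N (gam d) _ mG) => z.
by apply: integral_ge0 => y _; exact: f0.
Qed.

(** Orthogonality is recorded together with the invariance of the integrals so
that these matrices are closed under transposition. *)
Definition gaussian_preserving d (Q : 'M[R]_d) : Prop :=
  Q *m Q^T = 1%:M /\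
  forall f : borelRd R d -> \bar R, measurable_fun setT f -> (forall z, 0 <= f z) ->
    \int[gam d]_z f (linRd Q z) = \int[gam d]_z f z.

Lemma gaussian_preserving1 d : gaussian_preserving (1%:M : 'M[R]_d).
Proof.
split=> [|f mf f0]; first by rewrite trmx1 mulmx1.
by apply: eq_integral => z _; rewrite linRd1.
Qed.

Lemma gaussian_preservingM d (Q Q' : 'M[R]_d) :
  gaussian_preserving Q -> gaussian_preserving Q' -> gaussian_preserving (Q *m Q').
Proof.
move=> [oQ iQ] [oQ' iQ']; split=> [|f mf f0].
  by rewrite trmx_mul mulmxA -(mulmxA Q) oQ' mulmx1.
under eq_integral do rewrite linRdM.
rewrite (iQ' (fun z => f (linRd Q z))) ?iQ //.
by apply: measurableT_comp => //; exact: measurable_linRd.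
Qed.

Lemma gaussian_preservingT d (Q : 'M[R]_d) :
  gaussian_preserving Q -> gaussian_preserving Q^T.
Proof.
move=> [oQ iQ]; have oQT : Q^T *m Q = 1%:M by exact: mulmx1C.
split=> [|f mf f0]; first by rewrite trmxK.
rewrite -(iQ (fun z => f (linRd Q^T z))) //.
  by apply: eq_integral => z _; rewrite -linRdM oQT linRd1.
by apply: measurableT_comp => //; exact: measurable_linRd.
Qed.

Lemma gaussian_preserving_block1 d (Q : 'M[R]_d) : gaussian_preserving Q ->
  gaussian_preserving (block_mx 1%:M 0 0 Q : 'M[R]_(1 + d)).
Proof.
move=> [oQ iQ]; split=> [|f mf f0].
  rewrite tr_block_mx mulmx_block !trmx0 !mulmx0 !mul0mx !addr0 !add0r oQ.
  by rewrite trmx1 mulmx1 -scalar_mx_block.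
have mQ : measurable_fun setT
    (fun z => f (linRd (block_mx 1%:M 0 0 Q : 'M[R]_(1 + d)) z)).
  by apply: measurableT_comp => //; exact: measurable_linRd.
apply: (etrans (std_gaussianS mQ (fun z => f0 _))).
apply: (etrans _ (esym (std_gaussianS mf f0))); apply: eq_integral => x _.
rewrite -(iQ (fun z => f (consRd (x, z)))) //.
  apply: eq_integral => z _; congr (f _); rewrite /linRd /consRd /=.
  by rewrite mul_block_col mul1mx !mul0mx addr0 add0r.
by apply: measurableT_comp => //; apply: measurableT_comp.
Qed.

Lemma gaussian_preserving_flip d :
  gaussian_preserving (block_mx (-1)%:M 0 0 1%:M : 'M[R]_(1 + d)).
Proof.
split=> [|f mf f0].
  rewrite tr_block_mx mulmx_block !trmx0 !mulmx0 !mul0mx !addr0 !add0r.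
  by rewrite trmx1 mulmx1 tr_scalar_mx -scalar_mxM mulrNN mulr1 -scalar_mx_block.
have mB : measurable_fun setT
    (fun z => f (linRd (block_mx (-1)%:M 0 0 1%:M : 'M[R]_(1 + d)) z)).
  by apply: measurableT_comp => //; exact: measurable_linRd.
apply: (etrans (std_gaussianS mB (fun z => f0 _))).
apply: (etrans _ (esym (std_gaussianS mf f0))).
pose g (x : measurableTypeR R) := \int[gam d]_z f (consRd (x, z)).
have mf' : measurable_fun setT (fun xz => f (@consRd R d xz)).
  by apply: measurableT_comp => //; exact: measurable_consRd.
have mg : measurable_fun setT g.
  exact: (@measurable_fun_fubini_tonelli_F _ _ _ _ _ (gam d) _ mf').
rewrite -[RHS](@normal_integralN g mg); last by move=> x; exact: integral_ge0.
apply: eq_integral => x _; apply: eq_integral => z _; congr (f _).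
rewrite /linRd /consRd /= mul_block_col mul1mx !mul0mx addr0 add0r.
by rewrite mul_scalar_mx scaleN1r raddfN.
Qed.

Lemma gaussian_preserving_rotation d (c s : R) :
  (c ^+ 2 + s ^+ 2 = 1)%R -> (0 <= c)%R ->
  gaussian_preserving (block_mx c%:M (row_mx (- s)%:M 0) (col_mx s%:M 0)
    (block_mx c%:M 0 0 1%:M) : 'M[R]_(1 + (1 + d))).
Proof.
move=> cs c0; split=> [|f mf f0].
  rewrite tr_block_mx mulmx_block tr_row_mx tr_col_mx tr_block_mx !tr_scalar_mx !trmx0.
  rewrite [RHS](@scalar_mx_block _ 1 (1 + d)); congr block_mx.
  - rewrite mul_row_col mulmx0 addr0 -!scalar_mxM mulrNN -!expr2.
    by rewrite -raddfD /= cs.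
  - rewrite mul_row_block !mulmx0 mul0mx !addr0 !mul_scalar_mx scale_row_mx.
    rewrite !scaler0 add_row_mx addr0 -[RHS]row_mx0; congr row_mx.
    by rewrite -!mul_scalar_mx -!scalar_mxM -raddfD /= mulNr mulrC subrr raddf0.
  - rewrite mul_block_col !mulmx0 mul0mx !addr0 !mul_mx_scalar scale_col_mx.
    rewrite !scaler0 add_col_mx addr0 -[RHS]col_mx0; congr col_mx.
    by rewrite -!mul_scalar_mx -!scalar_mxM -raddfD /= mulNr mulrC subrr raddf0.
  - rewrite mul_col_row !mulmx0 !mul0mx mulmx_block !mulmx0 !mul0mx mul1mx !addr0.
    rewrite add0r -!scalar_mxM (@add_block_mx _ 1 d 1 d) !addr0 !add0r.
    rewrite -raddfD /= -!expr2 addrC cs.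
    by rewrite -(@scalar_mx_block _ 1 d).
have mQ : measurable_fun setT (fun z => f (linRd (block_mx c%:M
    (row_mx (- s)%:M 0) (col_mx s%:M 0) (block_mx c%:M 0 0 1%:M)) z)).
  by apply: measurableT_comp => //; exact: measurable_linRd.
apply: (etrans (std_gaussianSS mQ (fun z => f0 _))).
apply: (etrans _ (esym (std_gaussianSS mf f0))); apply: eq_integral => z _.
pose g (w : (measurableTypeR R * measurableTypeR R)%type) :=
  f (@consRd R d.+1 (w.1, @consRd R d (w.2, z))).
have mg : measurable_fun setT g.
  apply: measurableT_comp => //; apply: measurableT_comp; first exact: measurable_consRd.
  apply/measurable_fun_pair => //; apply: measurableT_comp; first exact: measurable_consRd.
  exact/measurable_fun_pair.
apply: (etrans _ (normal2_rotation cs c0 mg (fun w => f0 _))).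
apply: eq_integral => x _; apply: eq_integral => y _.
rewrite /g /linRd /consRd /=; congr (f _).
rewrite mul_block_col mul_row_col mul_col_mx mul_block_col.
rewrite !mul0mx !mul1mx !addr0 !add0r (@add_col_mx _ 1 d 1).
by rewrite -!scalar_mxM -!raddfD /= add0r mulNr.
Qed.

End rotation_invariance.

(** * Reflections and matrices with equal Gram matrices *)

Section gram.
Context {R : realType}.

(** Rotate the last coordinates onto their first axis by induction, then finish
with a plane rotation in the first two coordinates. The sign of [r] is left
free, so that the plane rotation can be taken with a non-negative cosine. *)
Lemma gaussian_preserving_axis d (v : 'cV[R]_(1 + d)) :
  exists (Q : 'M[R]_(1 + d)) (r : R), gaussian_preserving Q /\ Q *m v = col_mx r%:M 0.
Proof.
elim: d v => [|d IH] v.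
  exists 1%:M, (usubmx v ord0 ord0); split; first exact: gaussian_preserving1.
  by rewrite mul1mx -[LHS]vsubmxK -mx11_scalar [dsubmx v]flatmx0.
pose a := usubmx v ord0 ord0.
have [Q [b [iQ Qw]]] := IH (dsubmx v : 'cV[R]_(1 + d)).
pose Q1 : 'M[R]_(1 + (1 + d)) := block_mx 1%:M 0 0 Q.
have iQ1 : gaussian_preserving Q1 := gaussian_preserving_block1 iQ.
have Q1v : Q1 *m v = col_mx a%:M (col_mx b%:M 0 : 'cV[R]_(1 + d)).
  rewrite -[v]vsubmxK mul_block_col mul1mx !mul0mx addr0 add0r Qw.
  by rewrite [usubmx v]mx11_scalar.
(* t is the final coordinate, with the sign of a so that the cosine is >= 0 *)
have [t [t2 ta]] : exists t, t ^+ 2 = a ^+ 2 + b ^+ 2 /\ 0 <= a / t.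
  have ab0 : 0 <= a ^+ 2 + b ^+ 2 by rewrite addr_ge0 ?sqr_ge0.
  have [a0|a0] := leP 0 a.
    by exists (Num.sqrt (a ^+ 2 + b ^+ 2)); rewrite sqr_sqrtr // divr_ge0 ?sqrtr_ge0.
  exists (- Num.sqrt (a ^+ 2 + b ^+ 2)); rewrite sqrrN sqr_sqrtr //; split=> //.
  by rewrite invrN mulrN -mulNr divr_ge0 ?sqrtr_ge0 // oppr_ge0 ltW.
have [t0|tn0] := eqVneq t 0.
  have a0 : a = 0.
    apply/eqP; rewrite -sqrf_eq0 eq_le sqr_ge0 andbT.
    by have := sqr_ge0 b; rewrite t0 in t2; nra.
  have b0 : b = 0.
    apply/eqP; rewrite -sqrf_eq0 eq_le sqr_ge0 andbT.
    by have := sqr_ge0 a; rewrite t0 in t2; nra.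
  exists Q1, 0; split=> //; rewrite Q1v a0 b0 !raddf0.
  by rewrite (@col_mx0 _ 1 d 1).
pose c := a / t; pose s := - b / t.
have cs : c ^+ 2 + s ^+ 2 = 1.
  by rewrite /c /s !expr_div_n sqrrN -mulrDl -t2 divff // expf_neq0.
exists (block_mx c%:M (row_mx (- s)%:M 0) (col_mx s%:M 0)
    (block_mx c%:M 0 0 1%:M) *m Q1 : 'M[R]_(1 + (1 + d))), t; split.
  by apply: gaussian_preservingM => //; exact: gaussian_preserving_rotation.
rewrite -mulmxA Q1v mul_block_col mul_row_col.
rewrite (@mul_col_mx _ 1 d 1 1) (@mul_block_col _ 1 d 1 d 1).
rewrite !mulmx0 !mul0mx !addr0 (@add_col_mx _ 1 d 1) !addr0 -!scalar_mxM -!raddfD /=.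
have -> : c * a + - s * b = t.
  rewrite /c /s; apply: (mulIf tn0); rewrite -expr2 t2; field.
  exact: tn0.
have -> : s * a + c * b = 0 by rewrite /c /s; field.
by rewrite raddf0 (@col_mx0 _ 1 d 1).
Qed.

(** The reflection across the hyperplane orthogonal to [v = k - l]: as [k] and [l]
have the same norm, [k + l] is orthogonal to [v], so it exchanges [k] and [l].
It preserves the Gaussian law because it is conjugate, by a matrix sending [v] to
the first axis, to a sign change of the first coordinate. *)
Lemma gaussian_preserving_reflect d (k l : 'cV[R]_(1 + d)) : k^T *m k = l^T *m l ->
  exists H : 'M[R]_(1 + d), [/\ gaussian_preserving H, H *m k = l &
    forall n (w : 'M[R]_(1 + d, n)), w^T *m k = w^T *m l -> H *m w = w].
Proof.
move=> kl; pose v := k - l.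
have [v0|vn0] := eqVneq v 0.
  exists 1%:M; split=> [||n w _]; rewrite ?mul1mx //; first exact: gaussian_preserving1.
  by apply/eqP; rewrite -subr_eq0 -/v v0.
have [Q [r [iQ Qv]]] := gaussian_preserving_axis v.
have QTQ : Q^T *m Q = 1%:M by apply: mulmx1C; case: iQ.
have rn0 : r != 0.
  apply: contra_neq vn0 => r0; rewrite -[v]mul1mx -QTQ -mulmxA Qv r0 raddf0.
  by rewrite (@col_mx0 _ 1 d 1) mulmx0.
pose B : 'M[R]_(1 + d) := block_mx (-1)%:M 0 0 1%:M.
pose H := Q^T *m B *m Q.
have Hv : H *m v = - v.
  rewrite /H -!mulmxA Qv mul_block_col mul1mx !mul0mx addr0 add0r.
  have -> : (-1)%:M *m r%:M = - r%:M :> 'M[R]_1 by rewrite mul_scalar_mx scaleN1r.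
  have -> : col_mx (- r%:M) 0 = - col_mx r%:M 0 :> 'cV[R]_(1 + d).
    by rewrite (@opp_col_mx _ 1 d 1) oppr0.
  by rewrite mulmxN -Qv mulmxA QTQ mul1mx.
have Hw n (w : 'M[R]_(1 + d, n)) : w^T *m v = 0 -> H *m w = w.
  move=> wv; pose q := Q *m w.
  have qQ : q^T *m (Q *m v) = 0.
    by rewrite /q trmx_mul -mulmxA (mulmxA Q^T) QTQ mul1mx.
  have q0 : usubmx q = 0.
    move: qQ; rewrite Qv -[q]vsubmxK tr_col_mx mul_row_col mulmx0 addr0 mul_mx_scalar.
    move/eqP; rewrite scaler_eq0 (negbTE rn0) /= vsubmxK => /eqP q0.
    by apply: trmx_inj; rewrite q0 trmx0.
  have Bq : B *m q = q.
    rewrite -[q]vsubmxK q0 mul_block_col mul1mx !mulmx0 !mul0mx.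
    by rewrite !add0r.
  by rewrite /H -!mulmxA -/q Bq /q mulmxA QTQ mul1mx.
exists H; split.
- apply: gaussian_preservingM => //; apply: gaussian_preservingM.
    exact: gaussian_preservingT.
  exact: gaussian_preserving_flip.
- have s0 : H *m (k + l) = k + l.
    apply: Hw; rewrite [(k + l)^T]raddfD /= mulmxDl !mulmxBr kl.
    have -> : l^T *m k = k^T *m l.
      have t1 (A : 'M[R]_1) : A^T = A by rewrite [A]mx11_scalar tr_scalar_mx.
      by rewrite -[RHS]t1 trmx_mul trmxK.
    by rewrite addrACA [X in _ + X]addrC addrACA !subrr addr0.
  have := congr2 +%R Hv s0; rewrite -mulmxDr.
  have -> : v + (k + l) = 2 *: k.
    by rewrite /v addrACA addNr addr0 scaler_nat mulr2n.
  have -> : - v + (k + l) = 2 *: l.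
    by rewrite /v opprB [k + l]addrC addrACA addNr addr0 scaler_nat mulr2n.
  rewrite -scalemxAr => /(congr1 (fun x => 2^-1 *: x)).
  by rewrite !scalerA mulVf ?pnatr_eq0 // !scale1r.
- by move=> n w wkl; apply: Hw; rewrite mulmxBr wkl subrr.
Qed.

(** The rows are matched one at a time. Once the last rows agree, the reflection
that sends the next row of [K] to that of [L] fixes the rows already treated,
since these have the same inner products with both. *)
Lemma gram_eq_rotation d m (K L : 'M[R]_(d, 1 + m)) : K *m K^T = L *m L^T ->
  exists2 Q : 'M[R]_(1 + m), gaussian_preserving Q & K *m Q = L.
Proof.
elim: d K L => [|d IH] K L.
  exists 1%:M; first exact: gaussian_preserving1.
  by apply/matrixP => -[].
move: K L; rewrite -[d.+1]/(1 + d)%N => K L.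
rewrite -[K]vsubmxK -[L]vsubmxK.
move: (usubmx K) (usubmx L) (dsubmx K) (dsubmx L) => k l K' L'.
rewrite !tr_col_mx !mul_col_row => /(@eq_block_mx _ 1 d 1 d) [kl _ KLkl KL].
have [Q iQ KQ] := IH _ _ KL.
have QQ : Q *m Q^T = 1%:M by case: iQ.
have [|H [iH Hk Hw]] := @gaussian_preserving_reflect _ (k *m Q)^T l^T.
  by rewrite !trmxK trmx_mul mulmxA -(mulmxA k) QQ mulmx1.
exists (Q *m H^T).
  by apply: gaussian_preservingM => //; exact: gaussian_preservingT.
rewrite mul_col_mx !mulmxA; congr col_mx.
  by apply: trmx_inj; rewrite trmx_mul trmxK Hk.
rewrite KQ; apply: trmx_inj; rewrite trmx_mul trmxK.
apply: Hw; rewrite trmxK trmx_mul -KLkl -KQ mulmxA -(mulmxA K') QQ.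
by rewrite mulmx1.
Qed.

End gram.

(** * Linear images of the standard Gaussian law *)

Section gaussian_law.
Local Open Scope classical_set_scope.
Local Open Scope ereal_scope.
Context {R : realType}.
Local Notation N := (normal_prob (0:R) 1).
Local Notation gam d := (@std_gaussian R d).

(** Ignoring additional coordinates: this brings two matrices with different
numbers of columns to a common format. *)
Lemma linRd_pad d m n (K : 'M[R]_(d, m)) : (m <= n)%N ->
  exists K' : 'M[R]_(d, n), K' *m K'^T = K *m K^T /\
    forall f : borelRd R d -> \bar R, measurable_fun setT f -> (forall z, 0 <= f z) ->
      \int[gam n]_z f (linRd K' z) = \int[gam m]_z f (linRd K z).
Proof.
elim: n => [|n IH] mn.
  by move: mn K; rewrite leqn0 => /eqP-> K; exists K.
have [mn'|] := leqP m n; last first.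
  by move=> nm; have -> : n.+1 = m by [apply/eqP; rewrite eqn_leq nm mn]; exists K.
have [K' [KK iK]] := IH mn'.
exists (row_mx 0 K' : 'M[R]_(d, 1 + n)); split.
  by rewrite (@tr_row_mx _ d 1 n) (@mul_row_col _ d 1 n d) mul0mx add0r.
move=> f mf f0; rewrite -iK // std_gaussianS //; last first.
  by apply: measurableT_comp => //; exact: measurable_linRd.
transitivity (\int[N]_x (\int[gam n]_z f (linRd K' z))); last first.
  by rewrite integral_cst // [X in _ * X](@probability_setT _ _ R N) mule1.
apply: eq_integral => x _; apply: eq_integral => z _; congr (f _).
by rewrite /linRd /consRd /= (@mul_row_col _ d 1 n 1) mul0mx add0r.
Qed.

(** The law of [K Z], for [Z] standard Gaussian, is determined by its covariance
[K K^*], by [gram_eq_rotation]. Everything that follows about Gaussian laws is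
read on linear images of one standard Gaussian vector. *)
Lemma gaussian_law_gram d m m' (K : 'M[R]_(d, m)) (L : 'M[R]_(d, m'))
    (f : borelRd R d -> \bar R) :
  K *m K^T = L *m L^T -> measurable_fun setT f -> (forall z, 0 <= f z) ->
  \int[gam m]_z f (linRd K z) = \int[gam m']_z f (linRd L z).
Proof.
move=> KL mf f0.
have [K' [KK' <-//]] := @linRd_pad d m (1 + maxn m m')%N K
  (leqW (leq_maxl m m')).
have [L' [LL' <-//]] := @linRd_pad d m' (1 + maxn m m')%N L
  (leqW (leq_maxr m m')).
have [|Q [_ iQ] <-] := @gram_eq_rotation _ _ _ K' L'; first by rewrite KK' KL.
rewrite -(iQ (fun z => f (linRd K' z))) //; last first.
  by apply: measurableT_comp => //; exact: measurable_linRd.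
by apply: eq_integral => z _; rewrite -linRdM.
Qed.

Definition affRd m d (a : 'cV[R]_d) (K : 'M[R]_(d, m)) (z : borelRd R m) :
  borelRd R d := (a + K *m (z : 'cV[R]_m))%R.

Lemma affRdE m d (a : 'cV[R]_d) (K : 'M[R]_(d, m)) z :
  affRd a K z = affineRd a 1%:M (linRd K z).
Proof. by rewrite /affRd /affineRd mul1mx. Qed.

Lemma measurable_affRd m d (a : 'cV[R]_d) (K : 'M[R]_(d, m)) :
  measurable_fun setT (affRd a K).
Proof.
rewrite (_ : affRd a K = affineRd a 1%:M \o linRd K); last first.
  by apply/funext => z; exact: affRdE.
apply: measurableT_comp; first exact: measurable_affineRd.
exact: measurable_linRd.
Qed.

Lemma ge0_integral_gaussian d m (a : 'cV[R]_d) (K : 'M[R]_(d, m))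
    (f : borelRd R d -> \bar R) :
  measurable_fun setT f -> (forall z, 0 <= f z) ->
  \int[gaussian a (K *m K^T)]_x f x = \int[gam m]_z f (affRd a K z).
Proof.
move=> mf f0; rewrite /gaussian; set A := xget _ _.
(* the square root chosen in the definition need not be K, nor have its format *)
have AK : A *m A^T = K *m K^T.
  have [G GK] := psdmx_factor (psdmx_gram K).
  rewrite /A; case: xgetP => [A' _ //|/(_ G)].
  by rewrite /= -GK.
rewrite ge0_integral_distribution //.
transitivity (\int[gam d]_z f (affineRd a 1%:M (linRd A z))).
  by apply: eq_integral => z _; rewrite /= -affRdE.
rewrite (@gaussian_law_gram _ _ _ A K (f \o affineRd a 1%:M)) //; last 2 first.
- by apply: measurableT_comp => //; exact: measurable_affineRd.
- by move=> z; exact: f0.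
by apply: eq_integral => z _; rewrite affRdE.
Qed.

Lemma integral_gaussian d m (a : 'cV[R]_d) (K : 'M[R]_(d, m))
    (f : borelRd R d -> \bar R) :
  measurable_fun setT f ->
  \int[gaussian a (K *m K^T)]_x f x = \int[gam m]_z f (affRd a K z).
Proof.
move=> mf; rewrite integralE [RHS]integralE.
rewrite (ge0_integral_gaussian a K (measurable_funepos mf)); last first.
  by move=> z; exact: funepos_ge0.
rewrite (ge0_integral_gaussian a K (measurable_funeneg mf)); last first.
  by move=> z; exact: funeneg_ge0.
congr (_ - _); apply: eq_integral => z _.
- by rewrite !funeposE.
- by rewrite !funenegE.
Qed.

(** [E|Z|] for a standard normal [Z]. *)
Definition normal_abs_moment : \bar R := \int[N]_x `|x%:E|.

(** The integrand [|x| exp(-x^2/2)] is at most [exp(-x^2/4)], as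
[|x| <= 1 + x^2/4 <= exp(x^2/4)]; up to a constant, this is the density of the
centred normal law of variance 2. *)
Lemma normal_abs_moment_lty : normal_abs_moment < +oo.
Proof.
pose r2 : R := Num.sqrt 2.
have r20 : r2 != 0%R by rewrite sqrtr_eq0 -ltNge ltr0n.
have mabs : measurable_fun setT (fun x : measurableTypeR R => `|x%:E|).
  by apply: measurableT_comp => //; apply/measurable_EFinP.
rewrite /normal_abs_moment (ge0_integral_normal_prob _ _ mabs) //.
pose k : R := (normal_peak 1 / normal_peak r2)%R.
apply: (@le_lt_trans _ _ (\int[lebesgue_measure]_x (k%:E * (normal_pdf 0 r2 x)%:E))).
  apply: ge0_le_integral => //.
  - by move=> x _; rewrite mule_ge0 // lee_fin normal_pdf_ge0.
  - apply: emeasurable_funM => //; apply/measurable_EFinP; exact: measurable_normal_pdf.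
  - apply: emeasurable_funM => //; apply/measurable_EFinP; exact: measurable_normal_pdf.
  move=> x _; rewrite -EFinM -EFinM lee_fin !normal_pdfE ?oner_eq0 //.
  rewrite /k [leRHS]mulrA divfK; last by rewrite gt_eqF // normal_peak_gt0.
  rewrite mulrCA ler_wpM2l ?normal_peak_ge0 //.
  rewrite /normal_fun !subr0 expr1n sqr_sqrtr // /r2.
  have -> : (- x ^+ 2 / (1 *+ 2) = - x ^+ 2 / (2 *+ 2) + - x ^+ 2 / (2 *+ 2))%R by field.
  rewrite expRD mulrA -[leRHS]mul1r ler_wpM2r ?expR_ge0 //.
  rewrite -ler_pdivlMr ?expR_gt0 // div1r -expRN.
  apply: le_trans (expR_ge1Dx _).
  have -> : (1 + - (- x ^+ 2 / (2 *+ 2)) = 1 + (`|x| / 2) ^+ 2)%R.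
    by rewrite expr_div_n real_normK ?num_real //; field.
  have := sqr_ge0 (1 - `|x| / 2)%R; nra.
rewrite integralZl //; last exact: integrable_normal_pdf.
by rewrite integral_normal_pdf mule1 ltry.
Qed.

(** A null integral would concentrate the law at 0, but it has no atom. *)
Lemma normal_abs_moment_gt0 : 0 < normal_abs_moment.
Proof.
rewrite lt0e integral_ge0 // andbT; apply/eqP => c0.
have mabs : measurable_fun setT (fun x : measurableTypeR R => x%:E).
  by apply/measurable_EFinP.
have /(ae_eq_integral_abs N measurableT mabs) [A [mA A0 AP]] := c0.
have : N setT <= N A + N [set 0%R].
  have m0 : measurable [set (0%R : measurableTypeR R)] by exact: measurable_set1.
  apply: le_trans (measureU2 N mA m0).
  apply: le_measure; rewrite ?inE //; first exact: measurableU.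
  move=> x _ /=; have [->|x0] := eqVneq x 0%R; [by right|left].
  by apply: AP => /= /(_ I)[] /eqP; rewrite (negbTE x0).
rewrite A0 add0e probability_setT /normal_prob integral_set1.
by rewrite leNgt lte01.
Qed.

End gaussian_law.

(** * Convex functions under Gaussian laws *)

Section linear_forms.
Local Open Scope classical_set_scope.
Local Open Scope ereal_scope.
Context {R : realType}.
Local Notation N := (normal_prob (0:R) 1).
Local Notation gam d := (@std_gaussian R d).

Lemma integral_abs_linear_form m (k : 'M[R]_(1, m)) :
  \int[gam m]_z (`|(linRd k z : 'cV[R]_1) ord0 ord0|%R)%:E =
  (Num.sqrt ((k *m k^T) ord0 ord0))%:E * normal_abs_moment.
Proof.
set s := Num.sqrt _.
have mabs : measurable_fun setT
    (fun y : borelRd R 1 => (`|(y : 'cV[R]_1) ord0 ord0|%R)%:E).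
  by apply/measurable_EFinP; apply: measurableT_comp => //; exact: measurable_coordRd.
have [_ /(_ (1%:M : 'cV[R]_1))] := psdmx_gram k.
rewrite /qform trmx1 mul1mx mulmx1 => kk0.
rewrite (@gaussian_law_gram _ _ _ _ k (s%:M : 'M[R]_1)
  (fun y => (`|(y : 'cV[R]_1) ord0 ord0|%R)%:E)) //; last first.
  rewrite tr_scalar_mx -scalar_mxM -expr2 sqr_sqrtr //.
  exact: mx11_scalar.
rewrite std_gaussianS //; last first.
  apply: (measurableT_comp mabs); exact: measurable_linRd.
rewrite -ge0_integralZl //; last 2 first.
- by apply: measurableT_comp => //; apply/measurable_EFinP.
- by rewrite lee_fin sqrtr_ge0.
apply: eq_integral => x _.
transitivity (\int[gam 0]_z (s%:E * `|x%:E|)); last first.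
  by rewrite integral_cst // [X in _ * X](@probability_setT _ _ R (gam 0)) mule1.
apply: eq_integral => z _; rewrite -EFinM.
rewrite /linRd mul_scalar_mx mxE normrM ger0_norm ?sqrtr_ge0 //.
congr (_ * `|_|)%:E; rewrite /consRd /=.
have -> : ord0 = lshift 0 ord0 :> 'I_(1 + 0) by exact: val_inj.
by rewrite (@col_mxEu _ 1 0 1) !mxE -val_eqE mulr1n.
Qed.

(** The positive and negative parts are compared separately: subtraction of
extended reals is monotone even at infinite values. *)
Lemma le_integral_measurable dT (T : measurableType dT)
    (mu : {measure set T -> \bar R}) (f g : T -> \bar R) :
  measurable_fun setT f -> measurable_fun setT g -> (forall x, f x <= g x) ->
  \int[mu]_x f x <= \int[mu]_x g x.
Proof.
move=> mf mg fg; rewrite integralE [leRHS]integralE; apply: leeB.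
- apply: ge0_le_integral => //; [exact: measurable_funepos..|].
  by move=> x _; rewrite !funeposE ge_max !le_max (fg x) lexx orbT.
- apply: ge0_le_integral => //; [exact: measurable_funeneg..|].
  by move=> x _; rewrite !funenegE ge_max !le_max leeN2 (fg x) lexx orbT.
Qed.

End linear_forms.

Section convex_integrals.
Local Open Scope classical_set_scope.
Local Open Scope ereal_scope.
Context {R : realType} (d : nat) (phi : 'cV[R]_d -> R).
Hypothesis phi_convex : convex_function [set: convex_lmodType 'cV[R]_d] phi.
Local Notation gam d := (@std_gaussian R d).
Let F : borelRd R d -> \bar R := fun x => (phi x)%:E.

Lemma measurable_convex_EFin : measurable_fun setT F.
Proof. by apply/measurable_EFinP; exact: measurable_convex. Qed.

Lemma measurable_convex_aff m a (K : 'M[R]_(d, m)) :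
  measurable_fun setT (fun z => F (affRd a K z)).
Proof.
apply: measurableT_comp; first exact: measurable_convex_EFin.
exact: measurable_affRd.
Qed.

(** The negative part is bounded by [|phi a| + C sum_i |(K z)_i|] thanks to
[convex_lower_bound], and absolute values of linear forms are integrable. *)
Lemma integral_convex_neg_lty m a (K : 'M[R]_(d, m)) :
  \int[gam m]_z (fun z => F (affRd a K z))^\- z < +oo.
Proof.
have [C C0 lb] := convex_lower_bound phi_convex a.
pose G i (z : borelRd R m) : \bar R :=
  (`|(linRd (row i K) z : 'cV[R]_1) ord0 ord0|%R)%:E.
have G0 i z : 0 <= G i z by rewrite lee_fin.
have mG i : measurable_fun setT (G i).
  apply/measurable_EFinP; apply: measurableT_comp => //.
  apply: (measurableT_comp (measurable_coordRd ord0)); exact: measurable_linRd.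
apply: (@le_lt_trans _ _
  (\int[gam m]_z ((`|phi a|%R)%:E + C%:E * \sum_(i < d) G i z))).
  apply: ge0_le_integral => //.
  - by apply: measurable_funeneg; exact: measurable_convex_aff.
  - apply: emeasurable_funD => //; apply: emeasurable_funM => //.
    exact: emeasurable_sum.
  - move=> z _; rewrite funenegE /F ge_max; apply/andP; split; last first.
      by rewrite adde_ge0 // mule_ge0 // sume_ge0 // => i _; exact: G0.
    rewrite sumEFin -EFinM -EFinD -EFinN lee_fin.
    have := lb (K *m (z : 'cV[R]_m)); rewrite -/(affRd a K z).
    have -> : (\sum_i `|(K *m (z : 'cV[R]_m)) i ord0| =
        \sum_(i < d) `|(linRd (row i K) z : 'cV[R]_1) ord0 ord0|)%R.
      by apply: eq_bigr => i _; rewrite /linRd -row_mul [in RHS]mxE.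
    have := ler_norm (- phi a)%R; rewrite normrN; lra.
rewrite ge0_integralD //; last 2 first.
- by move=> z _; rewrite mule_ge0 // sume_ge0 // => i _; exact: G0.
- by apply: emeasurable_funM => //; exact: emeasurable_sum.
rewrite integral_cst // [X in _ * X](@probability_setT _ _ R (gam m)) mule1.
rewrite ge0_integralZl //; last 2 first.
- exact: emeasurable_sum.
- by move=> z _; rewrite sume_ge0 // => i _; exact: G0.
rewrite ge0_integral_sum //.
have c0 : 0 <= @normal_abs_moment R by rewrite ltW // normal_abs_moment_gt0.
have cfin : @normal_abs_moment R \is a fin_num.
  by rewrite ge0_fin_numE // normal_abs_moment_lty.
rewrite (eq_bigr (fun i => (Num.sqrt ((row i K *m (row i K)^T) ord0 ord0) *
   fine (@normal_abs_moment R))%:E)); last first.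
  by move=> i _; rewrite /G integral_abs_linear_form EFinM fineK.
by rewrite sumEFin -EFinM -EFinD ltry.
Qed.

(** Integration of Jensen's inequality. If one of the integrals on the right is
infinite, so is the sum, as none of them is [-oo]; otherwise everything is
integrable and the sum can be moved inside. *)
Lemma convex_jensen_integral (I : finType) (q : I -> R) m (a : I -> 'cV[R]_d)
    (K : I -> 'M[R]_(d, m)) :
  (forall i, 0 < q i)%R -> (\sum_i q i = 1)%R ->
  \int[gam m]_z F (affRd (\sum_i q i *: a i)%R (\sum_i q i *: K i)%R z) <=
  \sum_i (q i)%:E * \int[gam m]_z F (affRd (a i) (K i) z).
Proof.
move=> q0 q1.
pose f i z := F (affRd (a i) (K i) z).
have mf i : measurable_fun setT (f i) by exact: measurable_convex_aff.
have fneg i : \int[gam m]_z (f i)^\- z \is a fin_num.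
  rewrite ge0_fin_numE; first exact: integral_convex_neg_lty.
  by apply: integral_ge0 => z _; exact: funeneg_ge0.
have [/existsP[i /eqP fi]|/existsPn fpos] :=
    boolP [exists i, \int[gam m]_z (f i)^\+ z == +oo].
  have JNy j : \int[gam m]_z f j z != -oo.
    rewrite integralE -(fineK (fneg j)).
    have : 0 <= \int[gam m]_z (f j)^\+ z.
      by apply: integral_ge0 => z _; exact: funepos_ge0.
    by case: (\int[gam m]_z (f j)^\+ z).
  have Ny j : (q j)%:E * \int[gam m]_z f j z != -oo.
    move: (JNy j); case: (\int[gam m]_z f j z) => // _.
    by rewrite gt0_muley // lte_fin.
  suff -> : \sum_i (q i)%:E * \int[gam m]_z f i z = +oo by rewrite leey.
  apply/eqP; rewrite esum_eqy //; apply/existsP; exists i => /=.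
  rewrite integralE fi -(fineK (fneg i)) /=.
  by rewrite gt0_muley ?lte_fin // q0.
have int_nonneg g : measurable_fun setT g -> (forall z, 0 <= g z) ->
    \int[gam m]_z g z < +oo -> (gam m).-integrable setT g.
  move=> mg g0 glty; apply/integrableP; split=> //.
  by under eq_integral do rewrite gee0_abs //.
have intf i : (gam m).-integrable setT (f i).
  rewrite (funeposneg (f i)); apply: integrableB => //; apply: int_nonneg.
  - exact: measurable_funepos.
  - by move=> z; exact: funepos_ge0.
  - by rewrite ltey fpos.
  - exact: measurable_funeneg.
  - by move=> z; exact: funeneg_ge0.
  - exact: integral_convex_neg_lty.
have -> : \sum_i (q i)%:E * \int[gam m]_z F (affRd (a i) (K i) z) =
    \int[gam m]_z \sum_i (q i)%:E * f i z.
  rewrite (@integral_sum _ _ _ (gam m) _ measurableT _ (fun i z => (q i)%:E * f i z)).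
    by apply: eq_bigr => i _; rewrite (integralZl measurableT (intf i)).
  by move=> i; exact: integrableZl.
apply: le_integral_measurable.
- exact: measurable_convex_aff.
- apply: emeasurable_sum => i; exact: emeasurable_funM.
move=> z; rewrite /f /F -(eq_bigr _ (fun i _ => EFinM _ _)) sumEFin lee_fin.
have -> : affRd (\sum_i q i *: a i)%R (\sum_i q i *: K i)%R z =
    (\sum_i q i *: (affRd (a i) (K i) z : 'cV[R]_d))%R.
  rewrite /affRd mulmx_suml -big_split; apply: eq_bigr => i _ /=.
  by rewrite scalerDr scalemxAl.
by apply: convex_jensen_fin => // i; exact: ltW.
Qed.

End convex_integrals.

(** * From (B) to (C) to (D) *)

Section mixture_integral.
Local Open Scope classical_set_scope.
Local Open Scope ereal_scope.
Context {R : realType} (n : nat) (p : 'I_n -> R).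
Context dT (T : measurableType dT) (mu : 'I_n -> probability T R).
Hypothesis p_ge0 : forall i, (0 <= p i)%R.

(** [msum] sums the first terms of a sequence of measures, hence the indexing by
natural numbers. *)
Let mu_nat (k : nat) : {measure set T -> \bar R} :=
  if insub k is Some i then mscale (NngNum (p_ge0 i)) (mu i) else mzero.

Let mixtureE : mixture p mu = msum mu_nat n.
Proof. by apply/funext => A; apply: eq_bigr => i _; rewrite /mu_nat valK. Qed.

Lemma ge0_integral_mixture (f : T -> \bar R) :
  measurable_fun setT f -> (forall x, 0 <= f x) ->
  \int[mixture p mu]_x f x = \sum_(i < n) (p i)%:E * \int[mu i]_x f x.
Proof.
move=> mf f0; rewrite mixtureE ge0_integral_measure_sum //; apply: eq_bigr => i _.
by rewrite /mu_nat valK ge0_integral_mscale.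
Qed.

(** The finiteness of the negative parts rules out [oo - oo] when the sums of the
positive and of the negative parts are subtracted. *)
Lemma integral_mixture (f : T -> \bar R) : measurable_fun setT f ->
  (forall i, \int[mu i]_x f^\- x < +oo) ->
  \int[mixture p mu]_x f x = \sum_(i < n) (p i)%:E * \int[mu i]_x f x.
Proof.
move=> mf fneg.
have fin i : \int[mu i]_x f^\- x \is a fin_num.
  rewrite ge0_fin_numE //; apply: integral_ge0 => x _; exact: funeneg_ge0.
have -> : \int[mixture p mu]_x f x =
    \int[mixture p mu]_x f^\+ x - \int[mixture p mu]_x f^\- x.
  by rewrite mixtureE integralE.
rewrite (ge0_integral_mixture (measurable_funepos mf)); last first.
  by move=> x; exact: funepos_ge0.
rewrite (ge0_integral_mixture (measurable_funeneg mf)); last first.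
  by move=> x; exact: funeneg_ge0.
rewrite -fin_num_sumeN; last by move=> i _; rewrite fin_numM.
rewrite -big_split; apply: eq_bigr => i _ /=.
have def : \int[mu i]_x f^\+ x +? - \int[mu i]_x f^\- x.
  by apply: fin_num_adde_defl; rewrite fin_numN.
by rewrite [in RHS]integralE [RHS]muleBr.
Qed.

End mixture_integral.

Section conditions_B_C_D.
Local Open Scope classical_set_scope.
Local Open Scope ereal_scope.
Context {R : realType} (d n : nat) (p : 'I_n -> R).
Context (Sigma : 'M[R]_d) (Sig : 'I_n -> 'M[R]_d).
Hypothesis hSigma : psdmx Sigma.
Hypothesis hSig : forall i, psdmx (Sig i).
Hypothesis p_gt0 : forall i, (0 < p i)%R.
Hypothesis p_sum1 : (\sum_i p i = 1)%R.
Let p_ge0 i : (0 <= p i)%R := ltW (p_gt0 i).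

Lemma integral_mixture_gaussian m (phi : 'cV[R]_d -> R) (x : 'I_n -> 'cV[R]_d)
    (G : 'I_n -> 'M[R]_(d, m)) :
  convex_function [set: convex_lmodType 'cV[R]_d] phi ->
  \int[mixture p (fun i => gaussian (x i) (G i *m (G i)^T))]_y (phi y)%:E =
  \sum_i (p i)%:E * \int[@std_gaussian R m]_z (phi (affRd (x i) (G i) z))%:E.
Proof.
move=> cphi; have mphi := measurable_convex_EFin cphi.
rewrite integral_mixture //.
  by apply: eq_bigr => i _; rewrite (integral_gaussian (x i) (G i) mphi).
move=> i; rewrite (ge0_integral_gaussian (x i) (G i) (measurable_funeneg mphi)).
  have := integral_convex_neg_lty cphi (x i) (G i).
  under eq_integral do rewrite funenegE.
  by under [X in _ -> X < _]eq_integral do rewrite funenegE.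
by move=> z; exact: funeneg_ge0.
Qed.

(** With [S = A A^*] and [T - S = B B^*], the vectors [A Z + B Z'] and
[A Z - B Z'] both have the law of covariance [T], and their midpoint [A Z] has
that of covariance [S]; it remains to apply Jensen's inequality to the pair. *)
Lemma gaussian_loewner_convex (S T : 'M[R]_d) phi :
  convex_function [set: convex_lmodType 'cV[R]_d] phi ->
  psdmx S -> loewner_le S T ->
  \int[gaussian 0 S]_y (phi y)%:E <= \int[gaussian 0 T]_y (phi y)%:E.
Proof.
move=> cphi /psdmx_factor[A AE] /psdmx_factor[B BE].
have mphi := measurable_convex_EFin cphi.
pose K (b : bool) : 'M[R]_(d, d + d) := row_mx A ((-1) ^+ b *: B)%R.
pose q (b : bool) : R := (2^-1)%R.
have q1 : (\sum_b q b = 1)%R by rewrite big_bool /q /=; field.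
have := @convex_jensen_integral _ _ _ cphi _ q _ (fun=> 0%R) K _ q1.
pose K0 : 'M[R]_(d, d + d) := row_mx A 0%R.
have -> : (\sum_b q b *: K b = K0)%R.
  rewrite /K0 big_bool /= /K /q expr1 expr0 !scale_row_mx add_row_mx scale1r scaleN1r.
  rewrite scalerN addNr -scalerDl; congr row_mx.
  by rewrite (_ : 2^-1 + 2^-1 = 1)%R ?scale1r //; field.
rewrite big1 => [|b _]; last by rewrite scaler0.
rewrite -(integral_gaussian 0 K0 mphi).
have -> : K0 *m K0^T = S.
  by rewrite /K0 AE tr_row_mx mul_row_col mul0mx addr0.
have KK b : K b *m (K b)^T = T.
  rewrite /K tr_row_mx mul_row_col -AE linearZ /= -scalemxAl -scalemxAr scalerA.
  by rewrite -signr_addb addbb scale1r -BE addrC subrK.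
move=> J; apply: (le_trans (J _)); first by move=> b; rewrite /q invr_gt0 ltr0n.
rewrite big_bool /= -!(integral_gaussian 0 (K _) mphi) !KK /q.
rewrite -ge0_muleDl ?lee_fin ?invr_ge0 ?ler0n //.
by rewrite -EFinD (_ : 2^-1 + 2^-1 = 1)%R ?mul1e //; field.
Qed.

(** Factor [Gamma = G G^*] and let [G_i] be the [i]-th block of rows of [G]. The
vectors [x_i + G_i Z] have the laws of the mixture and their barycentre has
covariance [P Gamma P^*], which dominates [Sigma]. *)
Lemma condB_condC : condB p Sigma Sig -> condC p Sigma Sig.
Proof.
move=> [Gamma /= [/psdmx_factor[G GE] SP SigE]] x x0 phi cphi.
have mphi := measurable_convex_EFin cphi.
pose Gi i := submxcol G i.
have SigG i : Sig i = Gi i *m (Gi i)^T.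
  by rewrite -SigE GE submxblockEh -mul_submxrow -submxcol_mul tr_submxcol.
have -> : (fun i => gaussian (x i) (Sig i)) =
    (fun i => gaussian (x i) (Gi i *m (Gi i)^T)).
  by apply/funext => i; rewrite SigG.
rewrite integral_mixture_gaussian //.
apply: le_trans (gaussian_loewner_convex cphi hSigma SP) _.
set P := \mxrow__ _.
have -> : P *m Gamma *m P^T = P *m G *m (P *m G)^T.
  by rewrite GE trmx_mul !mulmxA.
rewrite (integral_gaussian 0 (P *m G) mphi) -x0.
have -> : P *m G = (\sum_i p i *: Gi i)%R.
  rewrite -[G in LHS]submxcolK mul_mxrow_mxcol; apply: eq_bigr => i _.
  by rewrite mul_scalar_mx.
exact: convex_jensen_integral.
Qed.

(** Test the convex order on [x |-> |xi^* x|] with all the shifts equal to 0: as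
[E|xi^* X|] is [sqrt (xi^* Sigma xi)] times the first absolute moment of the
standard normal law, that moment cancels on both sides. *)
Lemma condC_condD : condC p Sigma Sig -> condD p Sigma Sig.
Proof.
move=> hC xi.
pose phi (x : 'cV[R]_d) : R := (`|(xi^T *m x) ord0 ord0|)%R.
have cphi : convex_function [set: convex_lmodType 'cV[R]_d] phi.
  move=> t x y _ _.
  suff : (phi (t%:num *: x + (1 - t%:num) *: y) <=
          t%:num * phi x + (1 - t%:num) * phi y)%R by [].
  rewrite /phi mulmxDr -!scalemxAr mxE [X in (`|X + _|)%R]mxE [X in (`|_ + X|)%R]mxE.
  have t0 : (0 <= t%:num)%R by [].
  have t1 : (0 <= 1 - t%:num)%R by rewrite subr_ge0.
  apply: (le_trans (ler_normD _ _)).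
  by rewrite !normrM (ger0_norm t0) (ger0_norm t1).
have mphi := measurable_convex_EFin cphi.
have moment m (G : 'M[R]_(d, m)) :
    \int[@std_gaussian R m]_z (phi (affRd 0 G z))%:E =
    (Num.sqrt (qform (G *m G^T) xi))%:E * @normal_abs_moment R.
  have -> : qform (G *m G^T) xi = ((xi^T *m G) *m (xi^T *m G)^T) ord0 ord0.
    by rewrite /qform trmx_mul trmxK !mulmxA.
  rewrite -integral_abs_linear_form; apply: eq_integral => z _.
  by rewrite /phi /affRd /linRd add0r mulmxA.
have [A SA] := psdmx_factor hSigma.
have /choice[G SigG] i := psdmx_factor (hSig i).
have := hC (fun=> 0%R); rewrite big1 => [/(_ erefl _ cphi)|i _]; last by rewrite scaler0.
have -> : (fun i => gaussian 0 (Sig i)) = (fun i => gaussian 0 (G i *m (G i)^T)).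
  by apply/funext => i; rewrite SigG.
rewrite integral_mixture_gaussian // {1}SA (integral_gaussian 0 A mphi) moment -SA.
have cfin : @normal_abs_moment R \is a fin_num.
  by rewrite ge0_fin_numE ?normal_abs_moment_lty // ltW // normal_abs_moment_gt0.
under eq_bigr do rewrite moment -SigG -(fineK cfin) -!EFinM.
rewrite sumEFin -(fineK cfin) -EFinM lee_fin.
under eq_bigr do rewrite mulrA.
rewrite -mulr_suml ler_pM2r // fine_gt0 //.
by rewrite normal_abs_moment_gt0 normal_abs_moment_lty.
Qed.

End conditions_B_C_D.

Theorem theorem1p1 (R : realType) (d n : nat) (hd : (1 <= d)%N)
    (hn : (2 <= n)%N) (Sigma : 'M[R]_d) (Sig : 'I_n -> 'M[R]_d)
    (p : 'I_n -> R) (hSigma : psdmx Sigma) (hSig : forall i, psdmx (Sig i))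
    (hp : forall i, 0 < p i < 1) (hp1 : \sum_(i < n) p i = 1) :
  let A := condA p Sigma Sig in
  let B := condB p Sigma Sig in
  let C := condC p Sigma Sig in
  let D := condD p Sigma Sig in
  let equivalent := [/\ A <-> B, B <-> C & C <-> D] in
  [/\ [/\ A -> B, B -> C & C -> D],
      (colinear_family Sig -> equivalent) /\
      (d = 1%N -> colinear_family Sig),
      [/\ orthogonal_family Sig -> equivalent,
          forall N : 'M[R]_d, N \in unitmx -> forall i j, i != j ->
            (N *m Sig i *m N^T *m (N *m Sig j *m N^T) = 0 <->
             Sig i *m N^T *m N *m Sig j = 0) &
          (forall i j, i != j -> Sig i *m Sig j = 0) ->
            orthogonal_family Sig],
      [/\ commuting_family Sigma Sig -> equivalent,
          (forall i, comm_mx Sigma (Sig i)) ->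
            (forall i j, comm_mx (Sig i) (Sig j)) ->
            commuting_family Sigma Sig &
          (exists M : 'M[R]_d,
             [/\ M \in unitmx, is_diag_mx (M *m Sigma *m M^T) &
                 forall i, is_diag_mx (M *m Sig i *m M^T)]) ->
            commuting_family Sigma Sig] &
      common_corr p Sigma Sig -> equivalent].
Proof.
have p_gt0 i : 0 < p i by case/andP: (hp i).
have p_ge0 i : 0 <= p i := ltW (p_gt0 i).
move=> A B C D equivalent.
have AB : A -> B by exact: condA_condB.
have BC : B -> C by exact: condB_condC.
have CD : C -> D by exact: condC_condD.
have equivI : (D -> A) -> equivalent by move=> DA; split; tauto.
split.
- by split.
- split=> [cS|d1]; first by apply: equivI => hD; exact: colinear_condA.
  clear -hSig d1; subst d; exists 1%:M, (fun i => Sig i ord0 ord0); split=> [|i|i].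
  + exact: psdmx1.
  + exact: psdmx_diag_ge0.
  + by rewrite scalemx1 -mx11_scalar.
- split=> [oS|N uN i j _|SS].
  + by apply: equivI => hD; exact: orthogonal_condA.
  + have uNT : N^T \in unitmx by rewrite unitmx_tr.
    split=> [|E]; last first.
      by rewrite !mulmxA -(mulmxA N) -(mulmxA N) -(mulmxA N) E mulmx0 mul0mx.
    move=> /(congr1 (mulmx (invmx N)))/(congr1 (mulmxr (invmx N^T))) /=.
    by rewrite !mulmxA mulVmx // mul1mx mulmxK // mulmx0 mul0mx.
  + exists 1%:M => [|i j ij]; first exact: unitmx1.
    by rewrite trmx1 !mul1mx !mulmx1 SS.
- split=> [cS|cS cSS|[M [uM dS dSig]]].
  + by apply: equivI => hD; exact: commuting_condA.
  + exists 1%:M; split=> [|i|i j]; first exact: unitmx1.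
      by rewrite trmx1 !mul1mx !mulmx1.
    by rewrite trmx1 !mul1mx !mulmx1.
  + have diag_comm (S T : 'M[R]_d) : is_diag_mx S -> is_diag_mx T -> comm_mx S T.
      by move=> /diag_mxP[v ->] /diag_mxP[w ->]; exact: diag_mxC.
    by exists M; split=> // *; exact: diag_comm.
- by move=> cS; apply: equivI => hD; exact: common_corr_condA.
Qed.
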